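(* Let $T_5$ be the $5$-regular tree. Then $\mathrm{md}(\mathrm{Aut}(T_5))=5$; in particular $T_5$ is a Cayley–Abels graph of minimal degree for $\mathrm{Aut}(T_5)$.
   Context: $\mathrm{Aut}(T_5)$ carries the permutation topology (pointwise stabilizers of finite vertex sets form a neighbourhood basis of the identity), making it a totally disconnected, locally compact group. A Cayley–Abels graph for such a group $G$ is a connected, locally finite simple graph with an action of $G$ by automorphisms (not necessarily faithful) that is vertex-transitive with compact open vertex stabilizers; $\mathrm{md}(G)$ is the minimal degree of such a graph. *)

(* Defs.v *)
From Stdlib Require Import List Relations.
From mathcomp Require Import all_boot.
Set Implicit Arguments. Unset Strict Implicit. Unset Printing Implicit Defensive.

(* ---------- The 5-regular tree T_5 ----------
   Vertices: reduced words over the alphabet 'I_5 (no two consecutive letters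
   equal), i.e. elements of the free product of five copies of Z/2;
   two words are adjacent iff one is obtained from the other by adding one
   letter at the front.  This is the Cayley graph of Z/2*...*Z/2 (5 factors),
   the 5-regular tree. *)
Definition reduced (s : seq 'I_5) : bool := sorted (fun a b : 'I_5 => a != b) s.
Definition T5 : Type := {s : seq 'I_5 | reduced s}.
Definition T5adj (x y : T5) : Prop :=
  (proj1_sig x = behead (proj1_sig y) /\ size (proj1_sig y) = (size (proj1_sig x)).+1)
  \/ (proj1_sig y = behead (proj1_sig x) /\ size (proj1_sig x) = (size (proj1_sig y)).+1).

Definition is_graph_aut (V : Type) (adj : V -> V -> Prop) (f : V -> V) : Prop :=
  bijective f /\ forall x y, adj x y <-> adj (f x) (f y).
Definition Aut (V : Type) (adj : V -> V -> Prop) : Type := {f : V -> V | is_graph_aut adj f}.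
Definition autf V adj (g : @Aut V adj) : V -> V := proj1_sig g.

(* Permutation topology: the sets {h | h = g on F}, F finite, form a
   neighbourhood basis of g (these are the cosets g * Stab(F)). *)
Definition perm_open V adj (U : @Aut V adj -> Prop) : Prop :=
  forall g, U g -> exists F : list V,
    forall h, (forall x, In x F -> autf h x = autf g x) -> U h.

Definition perm_compact V adj (K : @Aut V adj -> Prop) : Prop :=
  forall (I : Type) (U : I -> @Aut V adj -> Prop),
    (forall i, perm_open (U i)) ->
    (forall g, K g -> exists i, U i g) ->
    exists l : list I, forall g, K g -> exists i, In i l /\ U i g.

Definition deg_at (W : Type) (adjW : W -> W -> Prop) (w : W) (d : nat) : Prop :=
  exists l : list W, NoDup l /\ length l = d /\ forall y, adjW w y <-> In y l.

Definition is_cayley_abels V adj (W : Type) (adjW : W -> W -> Prop)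
    (act : @Aut V adj -> W -> W) : Prop :=
  (forall x y, adjW x y -> adjW y x) /\ (forall x, ~ adjW x x) /\
  (forall x y, clos_refl_trans W adjW x y) /\
  (forall x, exists l : list W, forall y, adjW x y -> In y l) /\
  (forall g w, (forall x, autf g x = x) -> act g w = w) /\
  (forall g h k w, (forall x, autf k x = autf g (autf h x)) ->
      act k w = act g (act h w)) /\
  (forall g, is_graph_aut adjW (act g)) /\
  (forall x y, exists g, act g x = y) /\
  (forall w, perm_open (fun g => act g w = w) /\ perm_compact (fun g => act g w = w)).

Definition md_is V adj (d : nat) : Prop :=
  (exists (W : Type) (adjW : W -> W -> Prop) (act : @Aut V adj -> W -> W),
      is_cayley_abels adjW act /\ exists w, deg_at adjW w d) /\
  (forall (W : Type) (adjW : W -> W -> Prop) (act : @Aut V adj -> W -> W),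
      is_cayley_abels adjW act -> forall w d', deg_at adjW w d' -> d <= d').

Definition T5act (g : Aut T5adj) (v : T5) : T5 := autf g v.

(* Main.v *)
Require Import Defs.
From Stdlib Require Import List Relations Classical ClassicalEpsilon.
From mathcomp Require Import all_boot.
From mathcomp Require Import fingroup perm ssralg zmodp zify.
Set Implicit Arguments. Unset Strict Implicit. Unset Printing Implicit Defensive.
Import GRing.Theory.

(** T_5 is the Cayley graph of a free product of five copies of Z/2; its vertex stabilisers are
    compact by Koenig's lemma, which gives the upper bound.

    For the lower bound let W be a Cayley-Abels graph of degree at most 4.  A rotation cyclically
    permutes three branches at a vertex of T_5 and fixes the rest, so it acts on the neighbours of
    a vertex y of W that it fixes as the identity or as a 3-cycle.  Say that a half-tree e is active
    at y if all rotations supported in e fix y and some of them moves a neighbour of y.  Openness of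
    stabilisers and boundedness of their orbits in T_5 show that every y has an active half-tree.
    If all rotations in e fix y, then those in a proper half-subtree e' of e fix all neighbours of y:
    a rotation s is inverted by some b supported where s is, and combining b with copies of its
    inverse in other branches gives elements of the stabiliser of y that invert s or a conjugate of
    it.  An element inverting a 3-cycle of at most four points is odd, and these parities
    are incompatible.

    If the double transpositions of the branches of e never act nontrivially at a vertex where e is
    active, then the property that the rotations in the proper half-subtrees of e fix y propagates along
    the edges of W, which contradicts boundedness.  Otherwise the rotations in e act on the four neighbours of
    y as the alternating group, e is the only half-tree active at y, and W is arc-transitive; then
    the heads of the active half-trees take at most two values on W, although they form an
    invariant set of vertices of T_5. *)

Arguments reduced : simpl never.

(** * The tree as the Cayley graph of a free product *)

(** Left multiplication by the generator [a], an involution, so an equal first letter cancels. Then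
    [mulw] is the group product and [rev] the inverse. *)
Definition nb (a : 'I_5) (s : seq 'I_5) : seq 'I_5 :=
  if s is b :: s' then if a == b then s' else a :: s else [:: a].

Definition mulw (x y : seq 'I_5) : seq 'I_5 := foldr nb y x.

Lemma reduced_cons a s :
  reduced (a :: s) = (if s is b :: _ then a != b else true) && reduced s.
Proof. by case: s. Qed.

Lemma reduced_behead s : reduced s -> reduced (behead s).
Proof. by case: s => // a s; rewrite reduced_cons => /andP[]. Qed.

Lemma reduced_nb a s : reduced s -> reduced (nb a s).
Proof.
case: s => // b s hs /=; case: eqP => [_|/eqP ab]; first exact: (reduced_behead hs).
by rewrite reduced_cons ab.
Qed.

Lemma nbK a s : reduced s -> nb a (nb a s) = s.
Proof.
case: s => [|b s] hs /=; first by rewrite eqxx.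
case: eqP => [->|/eqP ab]; last by rewrite /= eqxx.
case: s hs => [|c s] // /[!reduced_cons] /andP[/negPf h _].
by rewrite /= h.
Qed.

Lemma reduced_mulw x y : reduced y -> reduced (mulw x y).
Proof. by move=> hy; elim: x => //= a x; exact: reduced_nb. Qed.

Lemma reduced_catl x y : reduced (x ++ y) -> reduced x.
Proof. by rewrite /reduced; case: x => // a x; rewrite cat_cons /= cat_path => /andP[]. Qed.

Lemma mulw_cat x y : reduced (x ++ y) -> mulw x y = x ++ y.
Proof.
elim: x => //= a x IH; rewrite reduced_cons => /andP[ha hr].
by rewrite IH //; case: (x ++ y) ha => //= b s /negPf ->.
Qed.

Lemma mulw0 x : reduced x -> mulw x [::] = x.
Proof. by move=> hx; rewrite mulw_cat cats0. Qed.

Lemma mulw_nb a w h : reduced w -> reduced h -> mulw (nb a w) h = nb a (mulw w h).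
Proof.
case: w => [|b w] //= hw hh; case: eqP => // ->.
by rewrite nbK // reduced_mulw.
Qed.

Lemma mulwA x y z : reduced y -> reduced z -> mulw (mulw x y) z = mulw x (mulw y z).
Proof.
by move=> hy hz; elim: x => //= a x <-; rewrite mulw_nb // reduced_mulw.
Qed.

Lemma reduced_rev s : reduced (rev s) = reduced s.
Proof.
by rewrite /reduced rev_sorted; apply: eq_sorted => a b /=; rewrite eq_sym.
Qed.

Lemma mulw_rev_cat x z : reduced (rev x ++ z) -> mulw x (rev x ++ z) = z.
Proof.
elim: x z => //= a x IH z; rewrite rev_cons cat_rcons => hr.
by rewrite IH //= eqxx.
Qed.

Lemma mulw_rev x : reduced x -> mulw x (rev x) = [::].
Proof. by move=> hx; rewrite -[rev x]cats0 mulw_rev_cat // cats0 reduced_rev. Qed.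

Lemma mul_revw x : reduced x -> mulw (rev x) x = [::].
Proof. by move=> hx; rewrite -{2}[x]revK mulw_rev // reduced_rev. Qed.

Lemma T5_inj (x y : T5) : sval x = sval y -> x = y.
Proof. exact: val_inj. Qed.

Definition T5root : T5 := exist _ [::] isT.

Definition nbT (a : 'I_5) (v : T5) : T5 := exist _ (nb a (sval v)) (reduced_nb a (proj2_sig v)).

Lemma T5adjP x y : T5adj x y <-> exists a, y = nbT a x.
Proof.
split.
  case: x y => [x hx] [y hy]; rewrite /T5adj /=; case=> [[ex sy]|[ey sx]].
    case: y hy ex sy => [|b y] hy //= ex _; subst x; exists b; apply: T5_inj => /=.
    by move: hy; rewrite reduced_cons => /andP[]; case: y hx => //= c y _ /negPf ->.
  case: x hx ey sx => [|b x] hx //= ey _; subst y; exists b; apply: T5_inj => /=.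
  by rewrite eqxx.
case=> a ->; case: x => [[|b x] hx]; rewrite /T5adj /=; first by left.
by case: eqP => _; [right | left].
Qed.

Lemma T5adj_nbT a x : T5adj x (nbT a x).
Proof. by apply/T5adjP; exists a. Qed.

Lemma T5adj_sym x y : T5adj x y -> T5adj y x.
Proof. by rewrite /T5adj => -[]; [right|left]. Qed.

Lemma T5adj_irr x : ~ T5adj x x.
Proof. by case=> -[_]; lia. Qed.

Lemma nbT_inj x : injective (nbT^~ x).
Proof.
move=> a b /(congr1 sval); case: x => [[|c x] hx] /=; first by case.
case: eqP => [->|ac]; case: eqP => [-> //|bc].
- by move/(congr1 size) => /=; lia.
- by move/(congr1 size) => /=; lia.
- by case.
Qed.

(** Edges are left multiplications by letters, so the graph distance is the word length of
    [x y^-1]. *)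
Definition dist (x y : T5) : nat := size (mulw (sval x) (rev (sval y))).

Lemma dist_nbT c x y :
  dist (nbT c x) y = size (nb c (mulw (sval x) (rev (sval y)))).
Proof. by rewrite /dist mulw_nb // ?reduced_rev; [case: x | case: y]. Qed.

Lemma distxx x : dist x x = 0.
Proof. by rewrite /dist mulw_rev //; case: x. Qed.

Lemma dist_eq0 x y : dist x y = 0 -> x = y.
Proof.
case: x y => [x hx] [y hy]; rewrite /dist /= => /size0nil e.
apply: T5_inj => /=; rewrite -(mulw0 hx) -(mul_revw hy) -mulwA ?e //.
by rewrite reduced_rev.
Qed.

Lemma dist_adj x x' y : T5adj x x' ->
  dist x y = (dist x' y).+1 \/ dist x' y = (dist x y).+1.
Proof.
case/T5adjP => c ->; rewrite dist_nbT /dist.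
by case: (mulw _ _) => [|b w] /=; [right | case: eqP; [left | right]].
Qed.

Lemma closer_exists x y : x <> y -> exists x', T5adj x x' /\ dist x y = (dist x' y).+1.
Proof.
move=> xy; case E: (mulw (sval x) (rev (sval y))) => [|a w].
  by case: xy; apply: dist_eq0; rewrite /dist E.
exists (nbT a x); split; first exact: T5adj_nbT.
by rewrite dist_nbT /dist E /= eqxx.
Qed.

(** Only the first letter of the reduced word [u z^-1] can cancel: this is where the graph is a
    tree. *)
Lemma closer_unique u c c' z : T5adj u c -> T5adj u c' ->
  dist u z = (dist c z).+1 -> dist u z = (dist c' z).+1 -> c = c'.
Proof.
case/T5adjP => a -> /T5adjP [b ->]; rewrite !dist_nbT /dist.
case: (mulw _ _) => [|k w] //=; case: eqP => [->|_]; case: eqP => [->|_] //=; lia.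
Qed.

(** * Automorphisms *)

Notation AutT5 := (Defs.Aut T5adj).

Coercion autf : Defs.Aut >-> Funclass.

Lemma aut_adj (g : AutT5) x y : T5adj (g x) (g y) <-> T5adj x y.
Proof. by case: g => f [? h] /=; rewrite -h. Qed.

Lemma aut_inj (g : AutT5) : injective g.
Proof. by case: g => f [h ?]; apply: bij_inj. Qed.

Lemma mk_aut f f' : cancel f f' -> cancel f' f ->
  (forall x y, T5adj x y -> T5adj (f x) (f y)) ->
  (forall x y, T5adj x y -> T5adj (f' x) (f' y)) -> is_graph_aut T5adj f.
Proof.
move=> k k' h h'; split; first by exists f'.
by move=> x y; split=> [/h //|/h']; rewrite !k.
Qed.

Definition aut_of f f' k k' h h' : AutT5 := exist _ f (@mk_aut f f' k k' h h').

Lemma aut1_subproof : is_graph_aut T5adj id.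
Proof. by apply: (@mk_aut id id). Qed.

Definition aut1 : AutT5 := exist _ id aut1_subproof.

Lemma autM_subproof (g h : AutT5) : is_graph_aut T5adj (g \o h).
Proof.
case: g h => [g [bg hg]] [h [bh hh]]; split; first exact: bij_comp.
by move=> x y /=; rewrite hh hg.
Qed.

Definition autM (g h : AutT5) : AutT5 := exist _ (g \o h) (autM_subproof g h).

Lemma autV_exists (g : AutT5) : exists h : AutT5, cancel g h /\ cancel h g.
Proof.
case: (g) => f [[f' k k'] hf]; have h' : is_graph_aut T5adj f'.
  by split; [exists f | move=> x y; rewrite (hf (f' x)) !k'].
by exists (exist _ f' h').
Qed.

Definition autV (g : AutT5) : AutT5 := proj1_sig (constructive_indefinite_description _ (autV_exists g)).

Lemma autVK (g : AutT5) : cancel g (autV g).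
Proof. by rewrite /autV; case: constructive_indefinite_description => h []. Qed.

Lemma autKV (g : AutT5) : cancel (autV g) g.
Proof. by rewrite /autV; case: constructive_indefinite_description => h []. Qed.

Lemma autME (g h : AutT5) x : autM g h x = g (h x). Proof. by []. Qed.

Lemma dist_aut (g : AutT5) x y : dist (g x) (g y) = dist x y.
Proof.
have le (h : AutT5) u v : dist (h u) (h v) <= dist u v.
  move En: (dist u v) => n; elim: n u En => [|n IH] u En.
    by rewrite (dist_eq0 En) distxx.
  have uv : u <> v by move=> e; rewrite e distxx in En.
  have [u' [a e]] := closer_exists uv.
  have /IH le1 : dist u' v = n by lia.
  by have [] := @dist_adj (h u) (h u') (h v) (iffRL (aut_adj h u u') a); lia.
apply/eqP; rewrite eqn_leq le /=.
by rewrite -{1}(autVK g x) -{1}(autVK g y) le.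
Qed.

(** * Right translations *)

Definition trT (h x : T5) : T5 := exist _ (mulw (sval x) (sval h)) (reduced_mulw (sval x) (proj2_sig h)).

Definition invT (h : T5) : T5 := exist _ (rev (sval h)) (eq_trans (reduced_rev (sval h)) (proj2_sig h)).

Lemma trTK h : cancel (trT h) (trT (invT h)).
Proof.
move=> x; apply: T5_inj => /=; case: x h => [x hx] [h hh] /=.
by rewrite mulwA // ?reduced_rev // mulw_rev // mulw0.
Qed.

Lemma invTK : involutive invT.
Proof. by move=> h; apply: T5_inj; rewrite /= revK. Qed.

Lemma trTVK h : cancel (trT (invT h)) (trT h).
Proof. by move=> x; rewrite -{1}(invTK h) trTK. Qed.

Lemma trT_nbT h a x : trT h (nbT a x) = nbT a (trT h x).
Proof. by apply: T5_inj; rewrite /= mulw_nb //; [case: x | case: h]. Qed.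

Lemma trT_adj h x y : T5adj x y -> T5adj (trT h x) (trT h y).
Proof. by case/T5adjP => a ->; rewrite trT_nbT; apply: T5adj_nbT. Qed.

Definition tr (h : T5) : AutT5 := aut_of (trTK h) (trTVK h) (@trT_adj h) (@trT_adj (invT h)).

Lemma tr_root h : tr h T5root = h.
Proof. exact: T5_inj. Qed.

Lemma tr_inv h : tr (invT h) h = T5root.
Proof. by apply: T5_inj; rewrite /= mulw_rev //; case: h. Qed.

Lemma dist_root x : dist x T5root = size (sval x).
Proof. by rewrite /dist /= mulw0 //; case: x. Qed.

Lemma distC x y : dist x y = dist y x.
Proof.
rewrite -(dist_aut (tr (invT y)) x y) -(dist_aut (tr (invT y)) y x) !tr_inv.
by rewrite dist_root /dist /= size_rev.
Qed.

(** * Half-trees *)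

Definition inT (t u z : T5) : Prop := dist z u < dist z t.

Lemma dist_adjr t u z : T5adj t u -> dist z t = (dist z u).+1 \/ dist z u = (dist z t).+1.
Proof. by move=> /(dist_adj z); rewrite !(distC z). Qed.

Lemma inT_aut (g : AutT5) t u z : inT (g t) (g u) (g z) <-> inT t u z.
Proof. by rewrite /inT !dist_aut. Qed.

(** Translate [t] to the root. Then [u] becomes a one-letter word [a], [z] ends in [a] and [y] does
    not, so nothing cancels in [z y^-1]. *)
Lemma dist_cut t u z y : T5adj t u -> inT t u z -> ~ inT t u y ->
  dist z y = dist z u + 1 + dist t y.
Proof.
move=> tu; have tr0 := tr_inv t; set g := tr (invT t) in tr0.
rewrite -(inT_aut g t u z) -(inT_aut g t u y).
rewrite -(dist_aut g z y) -(dist_aut g z u) -(dist_aut g t y) tr0.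
have /T5adjP [a ->] : T5adj T5root (g u) by rewrite -tr0; apply/aut_adj.
move: (g z) (g y) => {}z {}y; case: z y => [z hz] [y hy].
rewrite /inT !dist_root /dist /= size_rev -/(rev [:: a]) => h1 h2.
have aE : rev [:: a] = [:: a] by [].
have notend s : reduced s -> (size (mulw s (rev [:: a])) < size s) ->
    exists s', s = rcons s' a.
  case: (lastP s) => // s' b hs lt; exists s'; congr rcons; apply/eqP; apply: contraTT lt => ba.
  rewrite -leqNgt aE mulw_cat ?size_cat; first by rewrite leq_addr.
  rewrite cats1 -[rcons _ _]revK reduced_rev !rev_rcons reduced_cons.
  by rewrite eq_sym ba -rev_rcons reduced_rev.
have [z' ez] := notend z hz h1; subst z.
have -> : mulw (rcons z' a) (rev [:: a]) = z'.
  rewrite aE -cats1 /mulw foldr_cat /= eqxx; apply: mulw0.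
  by apply: (@reduced_catl _ [:: a]); rewrite cats1.
have ry : reduced (a :: rev y).
  rewrite reduced_cons reduced_rev hy andbT.
  case: (lastP y) hy h2 => // y' b hy h2; rewrite rev_rcons.
  apply/eqP=> ab; apply: h2; subst b.
  rewrite aE -cats1 /mulw foldr_cat /= eqxx -/(mulw _ _) mulw0 ?size_cat ?addn1 //.
  by apply: (@reduced_catl _ [:: a]); rewrite cats1.
rewrite -cats1 /mulw foldr_cat /=.
have -> : nb a (rev y) = a :: rev y.
  by move: ry; rewrite reduced_cons; case: (rev y) => //= c ? /andP[/negPf ->].
rewrite -/(mulw _ _) mulw_cat ?size_cat /= ?size_rev; first by lia.
move: hz ry; rewrite /reduced -cats1; case: z' {h1} => // c z' /=.
by rewrite !cat_path /= andbT => /andP[-> ->].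
Qed.

Lemma inTP t u z : T5adj t u ->
  (inT t u z /\ dist z t = (dist z u).+1) \/ (~ inT t u z /\ dist z u = (dist z t).+1).
Proof. by move=> /(dist_adjr z); rewrite /inT => -[] e; [left|right]; split=> //; lia. Qed.

Lemma inT_head t u : T5adj t u -> inT t u u.
Proof. by move=> /(dist_adjr u); rewrite /inT distxx; lia. Qed.

Lemma inT_tail t u : ~ inT t u t.
Proof. by rewrite /inT distxx. Qed.

Lemma inT_rev t u z : T5adj t u -> inT u t z <-> ~ inT t u z.
Proof. by move=> /(dist_adjr z); rewrite /inT; lia. Qed.

Lemma dist_adj1 x y : T5adj x y -> dist x y = 1.
Proof. by move=> /(dist_adj y); rewrite distxx; lia. Qed.

Lemma inT_branch u c c' z : T5adj u c -> T5adj u c' -> inT u c z -> inT u c' z -> c = c'.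
Proof.
move=> a a'; have [[_ e]|[]//] := inTP z a; have [[_ e']|[]//] := inTP z a' => _ _.
by apply: (closer_unique (z := z) a a'); rewrite !(distC _ z).
Qed.

Lemma branch_exists u z : u <> z -> exists2 c, T5adj u c & inT u c z.
Proof.
move=> /closer_exists [c [a e]]; exists c => //.
by rewrite /inT !(distC z) e.
Qed.

Lemma inT_cross t u z y : T5adj t u -> T5adj z y -> inT t u z -> ~ inT t u y ->
  z = u /\ y = t.
Proof.
move=> a zy hz hy; have := dist_cut a hz hy; rewrite (dist_adj1 zy) => e.
by split; [apply: dist_eq0 | apply/esym/dist_eq0]; lia.
Qed.

Lemma inT_nested t u t' u' z : T5adj t u -> T5adj t' u' ->
  inT t u t' -> ~ inT t' u' t -> inT t' u' z -> inT t u z.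
Proof.
move=> a a' h1 h2 h3; have [[//]|[nz _]] := inTP z a; exfalso.
have := dist_cut a h1 nz; have := dist_cut a' h3 h2.
have [[_]|[]//] := inTP z a'; rewrite !(distC z) (distC t' t) (distC t' z); lia.
Qed.

Lemma inT_disjoint t u t' u' z : T5adj t u -> T5adj t' u' ->
  ~ inT t u t' -> ~ inT t' u' t -> (t, u) <> (t', u') -> inT t' u' z -> ~ inT t u z.
Proof.
move=> a a' h1 h2 ne h3 h4; apply: ne.
have := dist_cut a h4 h1; have := dist_cut a' h3 h2.
have [[_ e1]|[]//] := inTP z a; have [[_ e2]|[]//] := inTP z a'.
rewrite (distC t' t) => e3 e4.
have tt : t = t' by apply: dist_eq0; lia.
rewrite -tt in a' e2 *; congr pair.
by apply: (closer_unique (z := z) a a'); rewrite !(distC _ z).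
Qed.

(* Half-trees are indexed by oriented edges (tail, head). *)

Definition edge (e : T5 * T5) : Prop := T5adj e.1 e.2.
Definition half (e : T5 * T5) (z : T5) : Prop := inT e.1 e.2 z.
Definition sube (e1 e2 : T5 * T5) : Prop := forall z, half e1 z -> half e2 z.
Definition child (e : T5 * T5) (c : T5) : Prop := T5adj e.2 c /\ c <> e.1.
Definition moveE (g : AutT5) (e : T5 * T5) : T5 * T5 := (g e.1, g e.2).
Definition disj (e1 e2 : T5 * T5) : Prop := forall z, half e1 z -> ~ half e2 z.
Definition ssub (e1 e2 : T5 * T5) : Prop :=
  exists2 c, child e2 c & sube e1 (e2.2, c).
(* The two half-trees cover the tree but are not complementary. *)
Definition codisj (e1 e2 : T5 * T5) : Prop :=
  [/\ half e1 e2.1, half e2 e1.1 & ~ (e2.1 = e1.2 /\ e2.2 = e1.1)].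

Lemma edge_move g e : edge (moveE g e) <-> edge e.
Proof. exact: aut_adj. Qed.

Lemma half_move g e z : half (moveE g e) (g z) <-> half e z.
Proof. exact: inT_aut. Qed.

Lemma moveEK g e : moveE (autV g) (moveE g e) = e.
Proof. by case: e => t u; rewrite /moveE /= !autVK. Qed.

Lemma sube_move g e1 e2 : sube e1 e2 -> sube (moveE g e1) (moveE g e2).
Proof. by move=> h z; rewrite -(autKV g z) !half_move; apply: h. Qed.

Lemma sube_refl e : sube e e. Proof. by []. Qed.

Lemma child_edge e c : child e c -> edge (e.2, c). Proof. by case. Qed.

Lemma child_sub e c : edge e -> child e c -> sube (e.2, c) e.
Proof.
move=> he [ac ne] z; apply: inT_nested => //=; first exact: inT_head.
by move=> h; apply: ne; have [e1 _] := inT_cross ac he h (@inT_tail _ _).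
Qed.

Lemma ssub_sub e1 e2 : edge e2 -> ssub e1 e2 -> sube e1 e2.
Proof. by move=> he [c hc h] z /h; apply: child_sub. Qed.

Lemma ssub_move g e1 e2 : ssub e1 e2 -> ssub (moveE g e1) (moveE g e2).
Proof.
case=> c [ac nc] h; exists (g c); last exact: (sube_move (g := g) h).
by split; [apply/aut_adj | move=> /aut_inj].
Qed.

Lemma ssub_tail e1 e2 : edge e1 -> edge e2 -> half e2 e1.1 -> ~ half e1 e2.1 -> ssub e1 e2.
Proof.
case: e1 e2 => [t' u'] [t u] /= a' a; rewrite /half /= => h1 h2.
case: (classic (t' = u)) => [e|ne].
  subst t'; exists u'; first split=> //= e; last exact: sube_refl.
  by apply: h2; rewrite e; apply: inT_head; apply: T5adj_sym.
have [c ac hc] := branch_exists (fun e => ne (esym e)).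
exists c.
  by split=> //= e; subst c; move/(inT_rev _ a): hc.
move=> z; apply: inT_nested => //= hu.
have [e1 e2] := inT_cross a' (T5adj_sym a) hu h2.
by move: h1; rewrite [t'](esym e2); apply: inT_tail.
Qed.

(** Decided by the tails: both in the other half-tree gives opposite edges or [codisj], exactly one
    gives nesting, none gives equality or disjointness. *)
Lemma edge_cases e1 e2 : edge e1 -> edge e2 ->
  e1 = e2 \/ disj e1 e2 \/ ssub e1 e2 \/ ssub e2 e1 \/ codisj e1 e2.
Proof.
move=> a1 a2; case: (classic (half e1 e2.1)) => h1; case: (classic (half e2 e1.1)) => h2.
- case: (classic (e2.1 = e1.2 /\ e2.2 = e1.1)) => [[e e']|ne].
    right; left => z; case: e1 e2 a1 a2 e e' {h1 h2} => [t u] [t' u'] /= a1 _ -> ->.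
    by rewrite /half /= => h /(inT_rev _ a1).
  by do 4 right.
- by do 3 right; left; apply: ssub_tail.
- by do 2 right; left; apply: ssub_tail.
- case: (classic (e1 = e2)) => [|ne]; [by left | right; left => z h h'].
  case: e1 e2 a1 a2 h1 h2 ne h h' => [t u] [t' u'] /= a1 a2 h1 h2 ne h h'.
  exact: (inT_disjoint a1 a2 h1 h2 ne h' h).
Qed.

Lemma ssub_asym e1 e2 : edge e1 -> edge e2 -> ssub e1 e2 -> ssub e2 e1 -> False.
Proof.
move=> a1 a2 [c hc h] /(ssub_sub a1) h'.
have : half (e2.2, c) e2.2 by apply: h; apply: h'; apply: inT_head.
exact: inT_tail.
Qed.

Lemma disj_sym e1 e2 : disj e1 e2 -> disj e2 e1.
Proof. by move=> h z h1 h2; apply: (h z). Qed.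

Lemma disj_branch u c c' : T5adj u c -> T5adj u c' -> c <> c' -> disj (u, c) (u, c').
Proof. by move=> a a' ne z h h'; apply: ne; apply: inT_branch h h'. Qed.

Lemma codisj_head_half e1 e2 : edge e1 -> edge e2 -> codisj e1 e2 ->
  half e1 e2.2 /\ half e2 e1.2.
Proof.
case: e1 e2 => [t u] [t' u']; rewrite /edge /half /codisj /= => a a' [h1 h2 h3].
split; apply: NNPP => h; apply: h3.
  exact: (inT_cross a a' h1 h).
by have [-> ->] := inT_cross a' a h2 h.
Qed.

(** [c] points towards the head of [e2]. Needed where only rotations in the children of [e1] are
    known to fix a vertex of W. *)
Lemma codisj_child e1 e2 : edge e1 -> edge e2 -> codisj e1 e2 -> e2.2 <> e1.2 ->
  exists2 c, child e1 c & codisj (e1.2, c) e2.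
Proof.
move=> a1 a2 cd ne; have [h1 h2] := codisj_head_half a1 a2 cd.
case: cd => h3 h4 h5.
have [c ac hc] := branch_exists (fun e => ne (esym e)).
exists c.
  by split=> // e; subst c; move/(inT_rev _ a1): hc.
split=> //=; last by case=> _ /ne.
apply: NNPP => h.
have [e e'] := inT_cross ac (T5adj_sym a2) hc h.
by move: h2; rewrite /half e'; apply: inT_tail.
Qed.

(** * Rigid stabilisers of half-trees *)

Definition rigid (e : T5 * T5) (g : AutT5) : Prop := forall z, ~ half e z -> g z = z.

Lemma rigid_half e g z : rigid e g -> half e z -> half e (g z).
Proof.
by move=> h hz; apply: NNPP => nz; apply: (nz); rewrite (aut_inj (h _ nz)).
Qed.

Lemma rigid_tail e g : rigid e g -> g e.1 = e.1.
Proof. by move=> h; apply: h; apply: inT_tail. Qed.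

Lemma rigid_head e g : edge e -> rigid e g -> g e.2 = e.2.
Proof.
move=> a h; case: (classic (half e (g e.2))) => [hg|/h /aut_inj //].
have ag : T5adj (g e.2) e.1 by rewrite -(rigid_tail h); apply/aut_adj/T5adj_sym.
by have [] := inT_cross a ag hg (@inT_tail _ _).
Qed.

Lemma rigid_move e g : edge e -> rigid e g -> moveE g e = e.
Proof. by case: e => t u a h; rewrite /moveE (rigid_tail h) (rigid_head a h). Qed.

Lemma rigid_mono e1 e2 g : sube e1 e2 -> rigid e1 g -> rigid e2 g.
Proof. by move=> h hg z nz; apply: hg => /h. Qed.

Lemma rigid_comm e1 e2 g h z : disj e1 e2 -> rigid e1 g -> rigid e2 h -> g (h z) = h (g z).
Proof.
move=> d hg hh; case: (classic (half e1 z)) => h1.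
  by rewrite (hh z (d _ h1)) (hh _ (d _ (rigid_half hg h1))).
rewrite (hg z h1); case: (classic (half e2 z)) => h2; last by rewrite (hh z h2) hg.
by apply: hg => h3; apply: (d _ h3); apply: rigid_half.
Qed.

Lemma rigidM e g h : rigid e g -> rigid e h -> rigid e (autM g h).
Proof. by move=> hg hh z nz; rewrite autME hh // hg. Qed.

Fact conjA_key : unit. Proof. exact: tt. Qed.

(* Locked: rewriting with autME would otherwise unfold it. *)
Definition conjA (g s : AutT5) : AutT5 := locked_with conjA_key (autM g (autM s (autV g))).

Lemma conjAE g s z : conjA g s (g z) = g (s z).
Proof. by rewrite /conjA unlock !autME autVK. Qed.

Lemma rigid_conj e g s : rigid e s -> rigid (moveE g e) (conjA g s).
Proof.
by move=> h z; rewrite -(autKV g z) half_move conjAE => /h ->.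
Qed.

Lemma rigidV e g : rigid e g -> rigid e (autV g).
Proof. by move=> h z nz; rewrite -{1}(h z nz) autVK. Qed.

(** * Permuting the branches at the root *)

Section RootBranches.

Local Open Scope ring_scope.

(* Shifting all letters by a constant modulo 5 identifies the five branches at the root
   consistently, so that rho is multiplicative in p. *)
Definition rhow (p : {perm 'I_5}) (s : seq 'I_5) : seq 'I_5 :=
  [seq b + (p (last 0 s) - last 0 s) | b <- s].

Lemma reduced_rhow p s : reduced s -> reduced (rhow p s).
Proof.
rewrite /reduced /rhow sorted_map; apply: sub_sorted => a b /= ab.
by apply: contraNN ab => /eqP /addIr ->.
Qed.

Lemma last_rhow p s : s != [::] -> last 0 (rhow p s) = p (last 0 s).
Proof.
case: s => // a s _; rewrite /rhow /= (last_map (fun b => b + _)).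
by rewrite addrC subrK.
Qed.

Lemma rhowM p q s : rhow q (rhow p s) = rhow (p * q)%g s.
Proof.
case: s => // a s; rewrite {1}/rhow last_rhow // /rhow -map_comp.
apply: eq_map => b; rewrite permM -[LHS]addrA; congr (b + _).
by rewrite addrC subrKA.
Qed.

Lemma rhow1 s : rhow 1%g s = s.
Proof. by rewrite /rhow -[RHS]map_id; apply: eq_map => b; rewrite perm1 subrr addr0. Qed.

Definition rhoT p (x : T5) : T5 := exist _ (rhow p (sval x)) (reduced_rhow p (proj2_sig x)).

Lemma rhoT_adj p x y : T5adj x y -> T5adj (rhoT p x) (rhoT p y).
Proof.
have aux (a b : seq 'I_5) : a = behead b -> size b = (size a).+1 ->
    rhow p a = behead (rhow p b) /\ size (rhow p b) = (size (rhow p a)).+1.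
  move=> -> ; rewrite /rhow !size_map => sb; split=> //.
  by case: b sb => //= c [|c' b].
by case=> -[h1 h2]; [left | right]; apply: aux.
Qed.

Lemma rhoTK p : cancel (rhoT p) (rhoT p^-1%g).
Proof. by move=> x; apply: T5_inj; rewrite /= rhowM mulgV rhow1. Qed.

Lemma rhoTVK p : cancel (rhoT p^-1%g) (rhoT p).
Proof. by move=> x; apply: T5_inj; rewrite /= rhowM mulVg rhow1. Qed.

Definition rho p : AutT5 := aut_of (rhoTK p) (rhoTVK p) (@rhoT_adj p) (@rhoT_adj p^-1%g).

Definition v1 (a : 'I_5) : T5 := nbT a T5root.

Lemma rhoM p q z : rho q (rho p z) = rho (p * q)%g z.
Proof. by apply: T5_inj; rewrite /= rhowM. Qed.

Lemma rho1 z : rho 1%g z = z.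
Proof. by apply: T5_inj; rewrite /= rhow1. Qed.

Lemma rho_root p : rho p T5root = T5root.
Proof. exact: T5_inj. Qed.

Lemma rho_v1 p a : rho p (v1 a) = v1 (p a).
Proof. by apply: T5_inj; rewrite /= /rhow /= addrC subrK. Qed.

Lemma inT_v1 a z : inT T5root (v1 a) z -> exists s, sval z = rcons s a.
Proof.
rewrite /inT dist_root /dist /=; case: z => z hz /=.
case: (lastP z) hz => // s b hz lt; exists s; congr rcons; apply/eqP; apply: contraTT lt => ba.
have -> : rev [:: a] = [:: a] by [].
rewrite -leqNgt mulw_cat ?size_cat; first by rewrite leq_addr.
rewrite cats1 -[rcons _ _]revK reduced_rev !rev_rcons reduced_cons.
by rewrite eq_sym ba -rev_rcons reduced_rev.
Qed.

Lemma rho_fix (p : {perm 'I_5}) a z : p a = a -> inT T5root (v1 a) z -> rho p z = z.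
Proof.
move=> pa /inT_v1 [s e]; apply: T5_inj; rewrite /= /rhow e last_rcons pa subrr.
by rewrite -[RHS]map_id; apply: eq_map => b; rewrite addr0.
Qed.

End RootBranches.

(** * Rotations *)

Definition o0 : 'I_5 := @Ordinal 5 0 isT.
Definition o1 : 'I_5 := @Ordinal 5 1 isT.
Definition o2 : 'I_5 := @Ordinal 5 2 isT.
Definition o3 : 'I_5 := @Ordinal 5 3 isT.
Definition o4 : 'I_5 := @Ordinal 5 4 isT.

Definition c012 : {perm 'I_5} := (tperm o0 o1 * tperm o0 o2)%g.

Ltac perm5 :=
  apply/permP => -[[|[|[|[|[|//]]]]] ?]; rewrite ?permM /tperm ?permE /=; by apply/val_inj.

Definition rot0 : AutT5 := rho c012.

Definition e0 : T5 * T5 := (v1 o4, T5root).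

(* The rotations supported in a half-tree: conjugates of rot0, which cyclically permutes three of the
   five branches at a vertex and fixes the other two; one of the latter contains the complement. *)
Definition Rot (e : T5 * T5) (s : AutT5) : Prop :=
  exists2 g : AutT5, (forall z, s (g z) = g (rot0 z)) & sube (moveE g e0) e.

Lemma edge_e0 : edge e0.
Proof. exact/T5adj_sym/T5adj_nbT. Qed.

Lemma rigid_rho (p : {perm 'I_5}) : p o4 = o4 -> rigid e0 (rho p).
Proof.
move=> pa z nz; apply: (rho_fix pa).
by apply/(inT_rev _ edge_e0).
Qed.

Lemma rot0_rigid : rigid e0 rot0.
Proof. by apply: rigid_rho; rewrite /c012 permM /tperm !permE /=; apply/val_inj. Qed.

Lemma rot0_3 z : rot0 (rot0 (rot0 z)) = z.
Proof. by rewrite /rot0 !rhoM (_ : (_ * _ = 1)%g) ?rho1 // /c012; perm5. Qed.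

Lemma Rot_rigid e s : Rot e s -> rigid e s.
Proof.
case=> g hs hg z nz; rewrite -(autKV g z) hs rot0_rigid // => h0.
by apply: nz; apply: hg; rewrite -(autKV g z) half_move.
Qed.

Lemma Rot_mono e1 e2 s : sube e1 e2 -> Rot e1 s -> Rot e2 s.
Proof. by move=> h [g hs hg]; exists g => // z /hg /h. Qed.

Lemma Rot_conj k e s : Rot e s -> Rot (moveE k e) (conjA k s).
Proof.
case=> g hs hg; exists (autM k g) => [z|]; first by rewrite !autME conjAE hs.
exact: (sube_move (g := k) hg).
Qed.

Lemma Rot3 e s z : Rot e s -> s (s (s z)) = z.
Proof. by case=> g hs _; rewrite -(autKV g z) !hs rot0_3. Qed.

(** Transposing two of the three rotated branches inverts the 3-cycle. This [b] is not given as a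
    product of rotations, so [fixR] does not directly apply to it. *)
Lemma Rot_inverter e s : Rot e s -> exists2 b, rigid e b & forall z, s (b (s z)) = b z.
Proof.
case=> g hs hg; exists (conjA g (rho (tperm o0 o1))).
  apply: (rigid_mono hg); apply: rigid_conj; apply: rigid_rho.
  by rewrite /tperm !permE /=; apply/val_inj.
move=> z; rewrite -(autKV g z) hs !conjAE hs /rot0 !rhoM.
by congr (g (rho _ _)); rewrite /c012; perm5.
Qed.

Lemma adj_root_v1 (x : T5) : T5adj T5root x -> exists a, x = v1 a.
Proof. by case/T5adjP => a ->; exists a. Qed.

Lemma star_transitive u t c c' : T5adj u t -> T5adj u c -> T5adj u c' ->
  t <> c -> t <> c' -> c <> c' ->
  exists g : AutT5, [/\ g T5root = u, g (v1 o4) = t, g (v1 o0) = c & g (v1 o1) = c'].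
Proof.
have hu := tr_root u; set h := tr u in hu.
have key x : T5adj u x -> exists a, x = h (v1 a).
  move=> a; have /adj_root_v1 [i e] : T5adj T5root (autV h x).
    by apply/(aut_adj h); rewrite autKV hu.
  by exists i; rewrite -e autKV.
move=> /key [i4 ->] /key [i0 ->] /key [i1 ->] n40 n41 n01.
have {}n40 : i4 != i0 by apply/eqP => e; apply: n40; rewrite e.
have {}n41 : i4 != i1 by apply/eqP => e; apply: n41; rewrite e.
have {}n01 : i0 != i1 by apply/eqP => e; apply: n01; rewrite e.
(* Three transpositions bring [i4], [i0], [i1] in turn to [o4], [o0], [o1], each fixing the letters
   already placed; the reversed product undoes this. *)
pose p := tperm o4 i4; pose q := tperm o0 (p i0); pose r := tperm o1 (q (p i1)).
have p4 : p i4 = o4 by rewrite /p tpermR.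
have q4 : q o4 = o4.
  by rewrite /q tpermD // -p4 (inj_eq perm_inj) eq_sym.
have q0 : q (p i0) = o0 by rewrite /q tpermR.
have r4 : r o4 = o4.
  by rewrite /r tpermD // -q4 -p4 !(inj_eq perm_inj) eq_sym.
have r0 : r o0 = o0.
  by rewrite /r tpermD // -q0 !(inj_eq perm_inj) eq_sym.
exists (autM h (rho (r * q * p)%g)); split; rewrite autME ?rho_root // rho_v1 !permM.
- by rewrite r4 q4 /p tpermL.
- by rewrite r0 /q tpermL /p tpermK.
- by rewrite /r tpermL /q tpermK /p tpermK.
Qed.

Lemma Rot_pure (g : AutT5) (p : {perm 'I_5}) :
  Rot (g (v1 (p o4)), g T5root) (conjA g (rho (c012 ^ p)%g)).
Proof.
exists (autM g (rho p)).
  by move=> z; rewrite (conjAE g _ (rho p z)) autME /rot0 !rhoM -conjgC.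
have -> : moveE (autM g (rho p)) e0 = (g (v1 (p o4)), g T5root).
  by rewrite -rho_v1 -(rho_root p).
exact: sube_refl.
Qed.

Lemma Rot_moves e c c' : edge e -> child e c -> child e c' -> c <> c' ->
  exists2 r, Rot e r & r c = c'.
Proof.
case: e => t u /= he [ac nc] [ac' nc'] ne.
have [g [gu gt gc gc']] := star_transitive (T5adj_sym he) ac ac'
  (fun e => nc (esym e)) (fun e => nc' (esym e)) ne.
exists (conjA g rot0).
  by exists g => [z|]; [rewrite conjAE | rewrite /moveE /= gu gt; apply: sube_refl].
rewrite -gc conjAE /rot0 rho_v1 -gc'; congr (g (v1 _)).
by rewrite /c012 permM /tperm !permE /=; apply/val_inj.
Qed.

(** Stands for the double transpositions of the branches. The factorisation makes [v] fix whatever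
    all rotations in [e] fix. *)
Definition Dbl (e : T5 * T5) (v : AutT5) : Prop :=
  exists r r', [/\ Rot e r, Rot e r', (forall z, v z = r (r' z)) & forall z, v (v z) = z].

Lemma Dbl_rigid e v : Dbl e v -> rigid e v.
Proof.
by case=> r [r' [/Rot_rigid h /Rot_rigid h' hv _]] z nz; rewrite hv h' // h.
Qed.

Lemma Dbl_conj k e v : Dbl e v -> Dbl (moveE k e) (conjA k v).
Proof.
case=> r [r' [h h' hv hh]]; exists (conjA k r), (conjA k r'); split.
- exact: Rot_conj.
- exact: Rot_conj.
- by move=> z; rewrite -(autKV k z) !conjAE hv.
- by move=> z; rewrite -(autKV k z) !conjAE hh.
Qed.

Lemma Dbl_rigid_conj e b v : edge e -> rigid e b -> Dbl e v -> Dbl e (conjA b v).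
Proof. by move=> he hb /(Dbl_conj b); rewrite rigid_move. Qed.

Lemma Dbl_pure (g : AutT5) (p r : {perm 'I_5}) : p o4 = o4 ->
  (c012 * c012 ^ p = r)%g -> (r * r = 1)%g -> Dbl (moveE g e0) (conjA g (rho r)).
Proof.
move=> p4 e rr; exists (conjA g (rho (c012 ^ p)%g)), (conjA g (rho (c012 ^ 1)%g)); split.
- by have := Rot_pure g p; rewrite p4.
- by have := Rot_pure g 1%g; rewrite perm1.
- by move=> z; rewrite -(autKV g z) !conjAE rhoM conjg1 e.
- by move=> z; rewrite -(autKV g z) !conjAE rhoM rr rho1.
Qed.

Lemma child_avoid e x : edge e -> exists2 c, child e c & c <> x.
Proof.
case: e => t u he; have /T5adjP [i /= ei] := T5adj_sym he.
have key (a b : 'I_5) : exists k, k != a /\ k != b.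
  case: (pickP (fun k : 'I_5 => (k != a) && (k != b))) => [k /andP|h]; first by exists k.
  have := h o0; have := h o1; have := h o2.
  by case: a b {h} => [a ?] [b ?]; rewrite -!val_eqE /=; lia.
have [k1 [k1i _]] := key i i; have [k2 [k2i k21]] := key i k1.
have chi k : k != i -> child (t, u) (nbT k u).
  by move=> h; split; [apply: T5adj_nbT | rewrite /= ei => /nbT_inj /eqP; apply/negP].
case: (classic (nbT k1 u = x)) => [<-|ne]; [exists (nbT k2 u) | exists (nbT k1 u)] => //; try exact: chi.
by move=> /nbT_inj /eqP; apply/negP.
Qed.

Lemma edge_transitive e : edge e -> exists g, moveE g e0 = e.
Proof.
move=> he; have [c [ac nc] _] := child_avoid e.1 he; have [c' [ac' nc'] ne] := child_avoid c he.
have [g [gu gt _ _]] := star_transitive (T5adj_sym he) ac ac'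
  (fun e => nc (esym e)) (fun e => nc' (esym e)) (fun e => ne (esym e)).
by exists g; rewrite /moveE /= gu gt; case: (e).
Qed.

Lemma Rot_moves_child e c : edge e -> child e c -> exists2 r, Rot e r & r c <> c.
Proof.
move=> he hc; have [c' hc' ne] := child_avoid c he.
have [r hr e'] := Rot_moves he hc hc' (fun e => ne (esym e)).
by exists r; rewrite ?e'.
Qed.

(** With [c] transported to branch [o0], use [(o0 o1)(o2 o3)] and [(o0 o2)(o1 o3)]; each is the
    product of [(o0 o1 o2)] and a conjugate of it. *)
Lemma Dbl_moves e c : edge e -> child e c ->
  exists v2 v3, [/\ Dbl e v2, Dbl e v3 & [/\ c <> v2 c, c <> v3 c & v2 c <> v3 c]].
Proof.
move=> he hc; have [c' [ac' nc'] ne] := child_avoid c he.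
case: e he hc ac' nc' => t u /= he [ac nc] ac' nc'.
have [g [gu gt gc gc']] := star_transitive (T5adj_sym he) ac ac'
  (fun e => nc (esym e)) (fun e => nc' (esym e)) (fun e => ne (esym e)).
have ge : moveE g e0 = (t, u) by rewrite /moveE /= gu gt.
have vne i j : i != j -> g (v1 i) <> g (v1 j) by move=> h /aut_inj /nbT_inj /eqP; apply/negP.
exists (conjA g (rho (tperm o0 o1 * tperm o2 o3)%g)), (conjA g (rho (tperm o0 o2 * tperm o1 o3)%g)); split.
- rewrite -ge; apply: (@Dbl_pure g (tperm o1 o3)) => //; last by perm5.
  + by rewrite tpermD.
  + by rewrite /c012 /conjg tpermV; perm5.
- rewrite -ge; apply: (@Dbl_pure g (tperm o0 o3)) => //; last by perm5.
  + by rewrite tpermD.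
  + by rewrite /c012 /conjg tpermV; perm5.
- rewrite -gc !conjAE !rho_v1 !permM !tpermL !tpermD //.
  by split; apply: vne.
Qed.

(** Among all five branches at the centre, [(o0 o1)(o3 o4)] inverts [(o0 o1 o2)] and is a product of
    two 3-cycles fixing branch [o2]: an even inverter. *)
Lemma Rot_center_even (g s : AutT5) : (forall z, s (g z) = g (rot0 z)) ->
  exists r1 r2, [/\ Rot (g (v1 o2), g T5root) r1, Rot (g (v1 o2), g T5root) r2 &
    forall z, s (r1 (r2 (s z))) = r1 (r2 z)].
Proof.
move=> hs; pose k := (tperm o2 o3 * tperm o2 o4)%g.
have k4 : k o4 = o2 by rewrite /k permM [tperm _ _ o4]tpermD // tpermR.
exists (conjA g (rho (c012 ^ (tperm o1 o3 * k))%g)), (conjA g (rho (c012 ^ k)%g)); split.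
- by have := Rot_pure g (tperm o1 o3 * k)%g; rewrite permM [tperm _ _ o4]tpermD // k4.
- by have := Rot_pure g k; rewrite k4.
have e : (c012 ^ k * c012 ^ (tperm o1 o3 * k) = tperm o0 o1 * tperm o3 o4)%g.
  rewrite [(c012 ^ (_ * k))%g]conjgM -conjMg (_ : (c012 * _ = tperm o0 o1 * tperm o2 o3)%g).
    rewrite conjMg !tpermJ; congr (tperm _ _ * tperm _ _)%g;
    by rewrite /k permM /tperm !permE /=; apply/val_inj.
  by rewrite /c012 /conjg tpermV; perm5.
move=> z; rewrite -(autKV g z) hs !conjAE [rho _ (rho _ _)]rhoM [rho _ (rho _ (autV _ _))]rhoM e.
rewrite hs /rot0 !rhoM; congr (g (rho _ _)); rewrite /c012; perm5.
Qed.

Lemma sube_cases e1 e2 : edge e1 -> edge e2 -> sube e1 e2 -> e1 = e2 \/ ssub e1 e2.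
Proof.
move=> a1 a2 h; have [|[d|[|[[c hc h']|[h1 _ _]]]]] := edge_cases a1 a2; try by [left|right].
- by case: (d e1.2); [|apply: h]; apply: inT_head.
- have : half (e1.2, c) e1.2 by apply: h'; apply: h; apply: inT_head.
  by move/inT_tail.
- by move/h/inT_tail: h1.
Qed.

Lemma conjAV g s z : conjA g (conjA (autV g) s) z = s z.
Proof. by rewrite -{1}(autKV g z) conjAE conjAE autKV. Qed.

Lemma vertex_exists n : exists z : T5, dist z T5root = n.
Proof.
elim: n => [|n [z ez]]; first by exists T5root; rewrite distxx.
case: (classic (z = T5root)) => [e|ne].
  exists (v1 o0); rewrite dist_root /=; move: ez; rewrite e distxx; lia.
have [x [ax ex]] := closer_exists ne.
have [c [ac nc] _] := child_avoid z (e := (x, z)) (T5adj_sym ax); exists c.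
have [e|e] := dist_adj T5root ac; last by rewrite e ez.
by case: nc; apply: (closer_unique ac ax e ex).
Qed.

Lemma edge_outward n : exists t u, [/\ T5adj t u, dist t T5root = n & dist u T5root = n.+1].
Proof.
have [u eu] := vertex_exists n.+1.
have ne : u <> T5root by move=> e; rewrite e distxx in eu.
have [t [a e]] := closer_exists ne; exists t, u.
by split=> //; [apply: T5adj_sym | lia].
Qed.

(** Let the head of a remote edge face the root. Rotating away the branch at the head that contains
    the root displaces the root by twice its distance to the head. *)
Lemma Rot_moves_far n : exists e r, [/\ edge e, Rot e r & n < dist T5root (r T5root)].
Proof.
have [u [t [ut eu et]]] := edge_outward n.+1.
have he : edge (t, u) by apply: T5adj_sym.
have ne : u <> T5root by move=> e; rewrite e distxx in eu.
have [c ac hc] := branch_exists ne.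
have chc : child (t, u) c.
  split=> //= e; subst c; move: hc; rewrite /inT !(distC T5root); lia.
have [r hr rc] := Rot_moves_child he chc; exists (t, u), r; split=> //.
have ru : r u = u by apply: (rigid_head he (Rot_rigid hr)).
have nin : ~ inT u c (r T5root).
  move=> h; apply: rc; apply: (@inT_branch u _ _ (r T5root)) => //.
    by rewrite -{1}ru; apply/aut_adj.
  by rewrite -{1}ru; apply/inT_aut.
rewrite (dist_cut ac hc nin) -{1}ru dist_aut; lia.
Qed.

(* Ping-pong: r and r' move the branches at the heads u and u' facing each other, so r r' increases
   the distance to u by 2 dist u u'. *)
Lemma codisj_unbounded e1 e2 : edge e1 -> edge e2 -> codisj e1 e2 -> e1.2 <> e2.2 ->
  exists r r', [/\ Rot e1 r, Rot e2 r' & forall n, n <= dist e1.2 (iter n (fun z => r (r' z)) e1.2)].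
Proof.
move=> a1 a2 cd ne; have [h2 h1] := codisj_head_half a1 a2 cd.
case: e1 e2 a1 a2 cd ne h1 h2 => [t u] [t' u'] a1 a2 _ ne; rewrite /half /= in ne * => h1 h2.
have [c ac hc] := branch_exists ne; have [c' ac' hc'] := branch_exists (fun e => ne (esym e)).
have chc : child (t, u) c by split=> //= e; subst c; move/(inT_rev _ a1): hc.
have chc' : child (t', u') c' by split=> //= e; subst c'; move/(inT_rev _ a2): hc'.
have [r hr rc] := Rot_moves_child a1 chc; have [r' hr' rc'] := Rot_moves_child a2 chc'.
have ru : r u = u by apply: (rigid_head a1 (Rot_rigid hr)).
have ru' : r' u' = u' by apply: (rigid_head a2 (Rot_rigid hr')).
exists r, r'; split=> //.
have Dpos : 0 < dist u u' by rewrite lt0n; apply/eqP => /dist_eq0.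
have Du : dist u' u = (dist u' c).+1 by have [[]|[]] := inTP u' ac.
have Du' : dist u u' = (dist u c').+1 by have [[]|[]] := inTP u ac'.
have sw (g : AutT5) v d z : g v = v -> T5adj v d -> g d <> d -> inT v d z -> ~ inT v d (g z).
  move=> gv ad gd hz h; apply: gd; apply: (@inT_branch v _ _ (g z)) => //.
    by rewrite -{1}gv; apply/aut_adj.
  by rewrite -{1}gv; apply/inT_aut.
have step y : ~ inT u c y ->
    ~ inT u c (r (r' y)) /\ dist u (r (r' y)) = dist u y + 2 * dist u u'.
  move=> hy; have e1 := dist_cut ac hc hy.
  have hy' : inT u' c' y.
    by apply: NNPP => h; have := dist_cut ac' hc' h; rewrite (distC u u') in Du'; lia.
  have hx := sw r' u' c' y ru' ac' rc' hy'.
  have e2 := dist_cut ac' hc' hx.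
  have e3 : dist u' (r' y) = dist u' y by rewrite -{1}ru' dist_aut.
  have hx' : inT u c (r' y).
    by apply: NNPP => h; have := dist_cut ac hc h; rewrite (distC u u') in Du'; lia.
  split; first exact: sw.
  by rewrite -{1}ru dist_aut; rewrite (distC u u') in Du' *; lia.
suff iter_far n : ~ inT u c (iter n (fun z => r (r' z)) u) /\
    n <= dist u (iter n (fun z => r (r' z)) u) by move=> n; case: (iter_far n).
elim: n => [|n [IH1 IH2]]; first by split=> //; apply: inT_tail.
by have [h3 h4] := step _ IH1; split=> //=; lia.
Qed.

(** * Permutations of at most four points *)

Definition P4 : seq (seq nat) := permutations (iota 0 4).
Definition comp4 (p q : seq nat) : seq nat := [seq nth 0 p i | i <- q].
Definition id4 : seq nat := iota 0 4.
Definition odd4 (p : seq nat) : bool :=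
  odd (count (fun ij => (ij.1 < ij.2) && (nth 0 p ij.2 < nth 0 p ij.1))
         [seq (i, j) | i <- iota 0 4, j <- iota 0 4]).

Lemma odd4_comp p q : p \in P4 -> q \in P4 -> odd4 (comp4 p q) = odd4 p (+) odd4 q.
Proof.
have /allP h : all (fun p => all (fun q => odd4 (comp4 p q) == odd4 p (+) odd4 q) P4) P4.
  by vm_compute.
by move=> /h /allP {}h /h /eqP.
Qed.

(** The last equation says that [a] conjugates [s] to its inverse; no 3-cycle is conjugate to its
    inverse within the alternating group [A_4]. *)
Lemma odd4_inverter s a : s \in P4 -> a \in P4 -> comp4 s (comp4 s s) = id4 ->
  comp4 s (comp4 a s) = a -> s = id4 \/ odd4 a.
Proof.
have /allP h : all (fun s => all (fun a =>
    if (comp4 s (comp4 s s) == id4) && (comp4 s (comp4 a s) == a)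
    then (s == id4) || odd4 a else true) P4) P4.
  by vm_compute.
by move=> /h /allP {}h /h {h} + e1 e2; rewrite e1 e2 !eqxx => /orP[/eqP|]; [left|right].
Qed.

Lemma odd4_cube r : r \in P4 -> comp4 r (comp4 r r) = id4 -> odd4 r = false.
Proof.
have /allP h : all (fun r => if comp4 r (comp4 r r) == id4 then ~~ odd4 r else true) P4.
  by vm_compute.
by move=> /h {h} + e; rewrite e eqxx => /negPf.
Qed.

(** The centraliser of a 3-cycle in [S_4] is the group of order 3 it generates. *)
Lemma centralizer4 s v : s \in P4 -> v \in P4 -> comp4 s (comp4 s s) = id4 ->
  comp4 v v = id4 -> comp4 s v = comp4 v s -> s = id4 \/ v = id4.
Proof.
have /allP h : all (fun s => all (fun v =>
    if [&& comp4 s (comp4 s s) == id4, comp4 v v == id4 & comp4 s v == comp4 v s]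
    then (s == id4) || (v == id4) else true) P4) P4.
  by vm_compute.
by move=> /h /allP {}h /h {h} + e1 e2 e3; rewrite e1 e2 e3 !eqxx => /orP[/eqP|/eqP]; [left|right].
Qed.

Fixpoint words (n : nat) : seq (seq bool) :=
  if n is n'.+1 then [::] :: [seq b :: w | b <- [:: true; false], w <- words n'] else [:: [::]].

(** If nontrivial, the even involution [r r'] is a double transposition and generates [A_4] together
    with a 3-cycle; words of length at most 3 suffice for transitivity. *)
Lemma transitive4 r r' : r \in P4 -> r' \in P4 -> comp4 r (comp4 r r) = id4 ->
  comp4 r' (comp4 r' r') = id4 -> comp4 (comp4 r r') (comp4 r r') = id4 ->
  comp4 r r' = id4 \/ forall i j, i < 4 -> j < 4 ->
    exists w, foldr (fun (b : bool) k => nth 0 (if b then r else r') k) i w = j.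
Proof.
have /allP h : all (fun r => all (fun r' =>
    if [&& comp4 r (comp4 r r) == id4, comp4 r' (comp4 r' r') == id4 &
           comp4 (comp4 r r') (comp4 r r') == id4]
    then (comp4 r r' == id4) || all (fun i => all (fun j =>
      has (fun w => foldr (fun (b : bool) k => nth 0 (if b then r else r') k) i w == j)
        (words 3)) (iota 0 4)) (iota 0 4)
    else true) P4) P4.
  by vm_compute.
move=> /h /allP {}h /h {h} + e1 e2 e3; rewrite e1 e2 e3 !eqxx => /orP[/eqP|/allP h]; [by left|right].
move=> i j li lj; have ii : i \in iota 0 4 by rewrite mem_iota.
have jj : j \in iota 0 4 by rewrite mem_iota.
by have /allP /(_ j jj) /hasP [w _ /eqP] := h i ii; exists w.
Qed.

(** * Coding local actions by permutations of four points *)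

Lemma In_nth_lt (W : Type) (x0 : W) l i : i < size l -> In (nth x0 l i) l.
Proof.
elim: l i => //= a s IH [|i] h /=; first by left.
by right; apply: IH.
Qed.

Lemma In_nthP (W : Type) (x0 : W) l x : In x l -> exists2 i, i < size l & nth x0 l i = x.
Proof.
elim: l => //= a s IH [->|/IH [i h e]]; first by exists 0.
by exists i.+1.
Qed.

Lemma nth_NoDup (W : Type) (x0 : W) l i j : NoDup l ->
  i < size l -> j < size l -> nth x0 l i = nth x0 l j -> i = j.
Proof.
elim: l i j => //= a s IH [|i] [|j] //= nd hi hj e; inversion nd as [|? ? na nds]; subst.
- by case: na; apply: In_nth_lt.
- by case: na; apply: In_nth_lt.
- by congr _.+1; apply: IH.
Qed.

Section Local.

Variables (W : Type) (x0 : W) (l : seq W).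
Hypotheses (nd : NoDup l) (sz : size l <= 4).

Definition lperm (f : W -> W) : Prop :=
  (forall x, In x l -> In (f x) l) /\ (forall x y, f x = f y -> x = y).

(** Indices past the end of [l] are fixed, so every degree up to four is handled in [S_4]. *)
Definition codes (f : W -> W) (p : seq nat) : Prop :=
  [/\ p \in P4, (forall i, i < size l -> nth 0 p i < size l /\ f (nth x0 l i) = nth x0 l (nth 0 p i)) &
      forall i, size l <= i -> i < 4 -> nth 0 p i = i].

Lemma P4P p : reflect (uniq p /\ p =i iota 0 4) (p \in P4).
Proof.
rewrite mem_permutations; apply: (iffP idP) => [h|[u e]].
  by split; [rewrite (perm_uniq h) iota_uniq | apply: perm_mem].
by apply: uniq_perm => //; apply: iota_uniq.
Qed.

Lemma P4_size p : p \in P4 -> size p = 4.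
Proof. by rewrite mem_permutations => /perm_size ->. Qed.

Lemma codes_exist f : lperm f -> exists p, codes f p.
Proof.
case=> fl fi.
have hj i : exists j, (i < size l -> j < size l /\ f (nth x0 l i) = nth x0 l j) /\ (size l <= i -> j = i).
  case: (ltnP i (size l)) => h; last by exists i.
  by have [j lj e] := In_nthP x0 (fl _ (In_nth_lt x0 h)); exists j.
pose F i := proj1_sig (constructive_indefinite_description _ (hj i)).
have FP i : (i < size l -> F i < size l /\ f (nth x0 l i) = nth x0 l (F i)) /\ (size l <= i -> F i = i).
  by rewrite /F; case: constructive_indefinite_description.
exists [seq F i | i <- iota 0 4].
have nthF i : i < 4 -> nth 0 [seq F i | i <- iota 0 4] i = F i.
  by move=> h; rewrite (nth_map 0) ?size_iota // nth_iota.
split.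
- have u : uniq [seq F i | i <- iota 0 4].
    rewrite map_inj_in_uniq ?iota_uniq // => i j _ _ e.
    have [[hi hi'] [hj1 hj2]] := (FP i, FP j).
    case: (ltnP i (size l)) => li; case: (ltnP j (size l)) => lj.
    + have [_ ei] := hi li; have [_ ej] := hj1 lj.
      by apply: (nth_NoDup (x0 := x0) nd) => //; apply: fi; rewrite ei ej e.
    + by have [] := hi li; rewrite e hj2 // ltnNge lj.
    + by have [] := hj1 lj; rewrite -e hi' // ltnNge li.
    + by rewrite -hi' // e hj2.
  have sub : {subset [seq F i | i <- iota 0 4] <= iota 0 4}.
    move=> j /mapP [i]; rewrite !mem_iota /= add0n => li ->.
    have [h h'] := FP i; case: (ltnP i (size l)) => hi; last by rewrite h'.
    by have [h1 _] := h hi; apply: leq_trans h1 sz.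
  by apply/P4P; split=> //; have [] := uniq_min_size u sub (leqnn _).
- move=> i hi; rewrite nthF; first exact: (FP i).1.
  exact: leq_trans hi sz.
- by move=> i hi li; rewrite nthF //; apply: (FP i).2.
Qed.

Lemma codes_comp f g p q : codes f p -> codes g q -> codes (f \o g) (comp4 p q).
Proof.
case=> hp fp1 fp2 [hq gq1 gq2].
have nthC i : i < 4 -> nth 0 (comp4 p q) i = nth 0 p (nth 0 q i).
  by move=> h; rewrite (nth_map 0) // P4_size.
have /P4P [up ip] := hp; have /P4P [uq iq] := hq.
split.
- have uc : uniq (comp4 p q).
    rewrite map_inj_in_uniq // => i j; rewrite !iq !mem_iota /= add0n => li lj /eqP.
    by rewrite nth_uniq ?P4_size // => /eqP.
  have sub : {subset comp4 p q <= iota 0 4}.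
    by move=> j /mapP [i]; rewrite iq mem_iota => li ->; rewrite -ip mem_nth // P4_size.
  have le4 : size (iota 0 4) <= size (comp4 p q) by rewrite size_map (P4_size hq).
  by apply/P4P; split=> //; have [] := uniq_min_size uc sub le4.
- move=> i hi; rewrite nthC; last exact: leq_trans hi sz.
  by have [h1 e1] := gq1 i hi; have [h2 e2] := fp1 _ h1; split=> //=; rewrite e1 e2.
- by move=> i hi li; rewrite nthC // gq2 // fp2.
Qed.

Lemma codes_id : codes id id4.
Proof.
split.
- by apply/P4P; split=> //; apply: iota_uniq.
- by move=> i hi; rewrite nth_iota ?add0n //; apply: leq_trans hi sz.
- by move=> i _ li; rewrite nth_iota.
Qed.

Lemma codes_eq f g p q : codes f p -> codes g q -> (forall x, In x l -> f x = g x) -> p = q.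
Proof.
case=> hp fp1 fp2 [hq gq1 gq2] e; apply: (@eq_from_nth _ 0); rewrite !P4_size // => i li.
case: (ltnP i (size l)) => hi; last by rewrite fp2 // gq2.
have [h1 e1] := fp1 i hi; have [h2 e2] := gq1 i hi.
by apply: (nth_NoDup (x0 := x0) nd) => //; rewrite -e1 -e2 e //; apply: In_nth_lt.
Qed.

Lemma codes_id_inv f : codes f id4 -> forall x, In x l -> f x = x.
Proof.
case=> _ h _ x /(In_nthP x0) [i hi <-]; have [_ ->] := h i hi.
by rewrite nth_iota //; apply: leq_trans hi sz.
Qed.

Notation fixes f := (forall x, In x l -> f x = x).

(* Both inverters a and a g of the 3-cycle s are odd, so g is even and cannot invert the conjugate s'. *)
Lemma local_inverters s s' a g v :
  lperm s -> lperm s' -> lperm a -> lperm g -> lperm v ->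
  (forall x, s (s (s x)) = x) -> (forall x, s (a (s x)) = a x) ->
  (forall x, s (a (g (s x))) = a (g x)) -> (forall x, s' (v x) = v (s x)) ->
  (forall x, s' (g (s' x)) = g x) -> (forall x, s' (s' (s' x)) = x) -> fixes s.
Proof.
move=> /codes_exist [p hs] /codes_exist [p' hs'] /codes_exist [q ha] /codes_exist [t hg] [vl vi].
move=> e1 e2 e3 e4 e5 e6.
have c1 := codes_eq (codes_comp hs (codes_comp hs hs)) codes_id (fun x _ => e1 x).
have c2 := codes_eq (codes_comp hs (codes_comp ha hs)) ha (fun x _ => e2 x).
have c3 := codes_eq (codes_comp hs (codes_comp (codes_comp ha hg) hs)) (codes_comp ha hg) (fun x _ => e3 x).
have c5 := codes_eq (codes_comp hs' (codes_comp hg hs')) hg (fun x _ => e5 x).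
have c6 := codes_eq (codes_comp hs' (codes_comp hs' hs')) codes_id (fun x _ => e6 x).
have [ps [pa [pg ps']]] : p \in P4 /\ q \in P4 /\ t \in P4 /\ p' \in P4.
  by case: hs; case: ha; case: hg; case: hs'.
have [pag _ _] := codes_comp ha hg.
have [i1|o1] := odd4_inverter ps pa c1 c2; first by subst p; apply: codes_id_inv.
have [i1|o2] := odd4_inverter ps pag c1 c3; first by subst p; apply: codes_id_inv.
have [i1|o3] := odd4_inverter ps' pg c6 c5; last by rewrite odd4_comp // o1 o3 in o2.
subst p' => x hx; apply: vi; rewrite -e4; apply: (codes_id_inv hs'); exact: vl.
Qed.

(** Permutations with trivial cube are even, hence so is [r1 r2], whereas a nontrivial [s] has only
    odd inverters. *)
Lemma local_even_inverter s r1 r2 : lperm s -> lperm r1 -> lperm r2 ->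
  (forall x, s (s (s x)) = x) -> (forall x, r1 (r1 (r1 x)) = x) -> (forall x, r2 (r2 (r2 x)) = x) ->
  (forall x, s (r1 (r2 (s x))) = r1 (r2 x)) -> fixes s.
Proof.
move=> /codes_exist [p hs] /codes_exist [q1 h1] /codes_exist [q2 h2] e1 e2 e3 e4.
have c1 := codes_eq (codes_comp hs (codes_comp hs hs)) codes_id (fun x _ => e1 x).
have c2 := codes_eq (codes_comp h1 (codes_comp h1 h1)) codes_id (fun x _ => e2 x).
have c3 := codes_eq (codes_comp h2 (codes_comp h2 h2)) codes_id (fun x _ => e3 x).
have c4 := codes_eq (codes_comp hs (codes_comp (codes_comp h1 h2) hs)) (codes_comp h1 h2) (fun x _ => e4 x).
have [ps [p1 p2]] : p \in P4 /\ q1 \in P4 /\ q2 \in P4 by case: hs; case: h1; case: h2.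
have [p12 _ _] := codes_comp h1 h2.
have [i1|] := odd4_inverter ps p12 c1 c4; first by subst p; apply: codes_id_inv.
by rewrite odd4_comp // (odd4_cube p1 c2) (odd4_cube p2 c3).
Qed.

Lemma local_centralizer s v : lperm s -> lperm v ->
  (forall x, s (s (s x)) = x) -> (forall x, v (v x) = x) -> (forall x, s (v x) = v (s x)) ->
  fixes s \/ fixes v.
Proof.
move=> /codes_exist [p hs] /codes_exist [q h1] e1 e2 e3.
have c1 := codes_eq (codes_comp hs (codes_comp hs hs)) codes_id (fun x _ => e1 x).
have c2 := codes_eq (codes_comp h1 h1) codes_id (fun x _ => e2 x).
have c3 := codes_eq (codes_comp hs h1) (codes_comp h1 hs) (fun x _ => e3 x).
have [ps p1] : p \in P4 /\ q \in P4 by case: hs; case: h1.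
by have [i1|i1] := centralizer4 ps p1 c1 c2 c3; subst; [left|right]; apply: codes_id_inv.
Qed.

Lemma local_transitive r r' : lperm r -> lperm r' ->
  (forall x, r (r (r x)) = x) -> (forall x, r' (r' (r' x)) = x) ->
  (forall x, r (r' (r (r' x))) = x) -> ~ fixes (r \o r') ->
  forall x y, In x l -> In y l ->
    exists w, foldr (fun (b : bool) z => if b then r z else r' z) x w = y.
Proof.
move=> /codes_exist [p hr] /codes_exist [p' hr'] e1 e2 e3 nf x y.
have c1 := codes_eq (codes_comp hr (codes_comp hr hr)) codes_id (fun x _ => e1 x).
have c2 := codes_eq (codes_comp hr' (codes_comp hr' hr')) codes_id (fun x _ => e2 x).
have hrr := codes_comp hr hr'.
have c3 := codes_eq (codes_comp hrr hrr) codes_id (fun x _ => e3 x).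
have [ps p1] : p \in P4 /\ p' \in P4 by case: hr; case: hr'.
have [i1|tr] := transitive4 ps p1 c1 c2 c3.
  by case: nf; apply: codes_id_inv; rewrite -i1.
move=> /(In_nthP x0) [i li <-] /(In_nthP x0) [j lj <-].
have [w hw] := tr i j (leq_trans li sz) (leq_trans lj sz); exists w.
rewrite -hw; suff [] : foldr (fun (b : bool) k => nth 0 (if b then p else p') k) i w < size l /\
  foldr (fun (b : bool) z => if b then r z else r' z) (nth x0 l i) w =
  nth x0 l (foldr (fun (b : bool) k => nth 0 (if b then p else p') k) i w) by [].
elim: w {hw} => //= b w [lt ->].
by case: b; [case: hr => _ h _ | case: hr' => _ h _]; apply: h.
Qed.

End Local.

(** * Cayley-Abels graphs of degree at most four *)

Section LowerBound.

Variables (W : Type) (adjW : W -> W -> Prop) (act : AutT5 -> W -> W) (w : W).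
Hypothesis CA : is_cayley_abels adjW act.
Hypothesis deg4 : forall x, exists l : list W,
  [/\ NoDup l, size l <= 4 & forall y, adjW x y <-> In y l].

Let adjW_sym x y : adjW x y -> adjW y x. Proof. by case: CA => + _; apply. Qed.

Lemma act_ext (g h : AutT5) x : (forall z, g z = h z) -> act g x = act h x.
Proof.
case: CA => _ [_ [_ [_ [i1 [iM _]]]]] e.
by rewrite (iM h aut1 g) ?(i1 aut1).
Qed.

Lemma actM g h x : act (autM g h) x = act g (act h x).
Proof. by case: CA => _ [_ [_ [_ [_ [iM _]]]]]; apply: iM. Qed.

Lemma act1 (g : AutT5) x : (forall z, g z = z) -> act g x = x.
Proof. by case: CA => _ [_ [_ [_ [i1 _]]]]; apply: i1. Qed.

Lemma actVK g : cancel (act g) (act (autV g)).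
Proof. by move=> x; rewrite -actM act1 // => z; rewrite autME autVK. Qed.

Lemma actKV g : cancel (act (autV g)) (act g).
Proof. by move=> x; rewrite -actM act1 // => z; rewrite autME autKV. Qed.

Lemma act_adj g x y : adjW (act g x) (act g y) <-> adjW x y.
Proof. by case: CA => _ [_ [_ [_ [_ [_ [h _]]]]]]; case: (h g) => _ <-. Qed.

Lemma act_transitive x y : exists g, act g x = y.
Proof. by case: CA => _ [_ [_ [_ [_ [_ [_ [h _]]]]]]]; apply: h. Qed.

Lemma adjW_ind (P : W -> Prop) x : P x -> (forall y z, adjW y z -> P y -> P z) -> forall y, P y.
Proof.
move=> hx step y; case: CA => _ [_ [+ _]] => /(_ x y) h.
by elim: h hx => [a b /step //|//|a b c _ h1 _ h2 /h1 /h2].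
Qed.

(** The open sets [g z = x] cover the compact stabiliser, so a finite subcover leaves finitely many
    images of [z]. *)
Lemma stab_bounded y z : exists N, forall g : AutT5, act g y = y -> dist z (g z) <= N.
Proof.
case: CA => _ [_ [_ [_ [_ [_ [_ [_ /(_ y) [_ cpt]]]]]]]].
have [|g _|l hl] := cpt T5 (fun x (g : AutT5) => g z = x).
- by move=> x g <-; exists [:: z] => h; apply; left.
- by exists (g z).
exists (\max_(x <- l) dist z x) => g /hl [x [+ ->]] {hl}.
elim: l => //= a l IH; rewrite big_cons => -[->|/IH]; first exact: leq_maxl.
by move=> /leq_trans; apply; apply: leq_maxr.
Qed.

Lemma act_conj g s y : act (conjA g s) (act g y) = act g (act s y).
Proof. by rewrite -!actM; apply: act_ext => z; rewrite !autME conjAE. Qed.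

(** * Half-trees active at a vertex of W *)

Definition trivN (s : AutT5) (y : W) : Prop := forall x, adjW y x -> act s x = x.

Lemma trivN_conj g s y : trivN (conjA g s) (act g y) -> trivN s y.
Proof.
move=> h x /(act_adj g) /h; rewrite act_conj => e.
by rewrite -(actVK g (act s x)) e actVK.
Qed.

Definition fixR (e : T5 * T5) (y : W) : Prop := forall s, Rot e s -> act s y = y.

Lemma fixR_move g e y : fixR e y -> fixR (moveE g e) (act g y).
Proof.
move=> h s hs; have hs' : Rot e (conjA (autV g) s) by rewrite -(moveEK g e); apply: Rot_conj.
rewrite -(act_ext _ (conjAV g s)) act_conj h //.
Qed.

Lemma fixR_mono e1 e2 y : sube e1 e2 -> fixR e2 y -> fixR e1 y.
Proof. by move=> h h2 s /(Rot_mono h); apply: h2. Qed.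

Definition active (y : W) (e : T5 * T5) : Prop :=
  [/\ edge e, fixR e y & exists2 s, Rot e s & ~ trivN s y].

Lemma active_move g y e : active y e -> active (act g y) (moveE g e).
Proof.
case=> he hf [s hs ns]; split; [by apply/edge_move | exact: fixR_move |].
by exists (conjA g s); [apply: Rot_conj | move/trivN_conj].
Qed.

Lemma nbr_lperm y l s : (forall x, adjW y x <-> In x l) -> act s y = y -> lperm l (act s).
Proof.
move=> hl sy; split; last by move=> x z /(can_inj (actVK s)).
by move=> x /hl h; apply/hl; rewrite -sy; apply/act_adj.
Qed.

Lemma act3 e s x : Rot e s -> act s (act s (act s x)) = x.
Proof. by move=> hs; rewrite -!actM; apply: act1 => z; rewrite !autME; apply: (Rot3 _ hs). Qed.

Lemma stabV g y : act g y = y -> act (autV g) y = y.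
Proof. by move=> {1}<-; rewrite actVK. Qed.

(** Weaker than [fixR e y], but enough for [child_inactive]; [tame_at_nbr] carries it to the
    neighbours of [y]. *)
Definition tame_at (e : T5 * T5) (y : W) : Prop :=
  (forall c, child e c -> fixR (e.2, c) y) /\ (forall v, Dbl e v -> act v y = y).

Lemma fixR_tame_at e y : edge e -> fixR e y -> tame_at e y.
Proof.
move=> he h; split=> [c hc|v [r [r' [hr hr' hv _]]]].
  by apply: fixR_mono h; apply: child_sub.
by rewrite (act_ext (h := autM r r')) // actM h ?h.
Qed.

(** The inverter [b] of [s] need not fix [y], so it is combined with inverses of its copies in the
    branches [v2 c] and [v3 c], which commute with [s]. *)
Lemma child_inactive e y c s : edge e -> tame_at e y -> child e c -> Rot (e.2, c) s -> trivN s y.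
Proof.
move=> he [hc hv] cc hs.
have ec : edge (e.2, c) by case: cc.
have [b rb bE] := Rot_inverter hs.
have reb : rigid e b by apply: rigid_mono rb; apply: child_sub.
have [v2 [v3 [d2 d3 [n12 n13 n23]]]] := Dbl_moves he cc.
have r2 := Dbl_rigid d2; have r3 := Dbl_rigid d3.
have u2 : v2 e.2 = e.2 by apply: rigid_head.
have u3 : v3 e.2 = e.2 by apply: rigid_head.
pose b2 := conjA v2 b; pose b3 := conjA v3 b; pose s2 := conjA v2 s.
have a2 : T5adj e.2 (v2 c) by rewrite -{1}u2; apply/aut_adj; case: cc.
have a3 : T5adj e.2 (v3 c) by rewrite -{1}u3; apply/aut_adj; case: cc.
have rb2 : rigid (e.2, v2 c) b2 by have := rigid_conj (g := v2) rb; rewrite /moveE /= u2.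
have rb3 : rigid (e.2, v3 c) b3 by have := rigid_conj (g := v3) rb; rewrite /moveE /= u3.
have Rs2 : Rot (e.2, v2 c) s2 by have := Rot_conj v2 hs; rewrite /moveE /= u2.
have rs := Rot_rigid hs; have rs2 := Rot_rigid Rs2.
have ac : T5adj e.2 c by case: cc.
have D12 := disj_branch ac a2 n12; have D13 := disj_branch ac a3 n13.
have D23 := disj_branch a2 a3 n23.
have fs : act s y = y by apply: (hc c).
have fs2 : act s2 y = y.
  by rewrite -[in LHS](hv v2 d2) act_conj fs hv.
(* [b (v b v^-1)^-1] equals [(b v b^-1) v^-1], a quotient of two elements of [Dbl e]. *)
have fb v : Dbl e v -> act (autM b (autV (conjA v b))) y = y.
  move=> dv; have e1 : act (autM (conjA b v) (autV v)) y = y.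
    by rewrite actM (stabV (hv v dv)); apply: hv; apply: Dbl_rigid_conj.
  rewrite -[RHS]e1; apply: act_ext => z; rewrite !autME.
  have [z' ->] : exists z', z = v (b z') by exists (autV b (autV v z)); rewrite !autKV.
  by rewrite autVK conjAE -{1}(conjAE v b z') autVK.
(* [a] and [a g = b b3^-1] invert [s], while [g] inverts [s2], the copy of [s] in the branch
   [v2 c]. *)
pose a := autM b (autV b2); pose g := autM b2 (autV b3).
have fa : act a y = y by apply: fb.
have ag z : a (g z) = b (autV b3 z) by rewrite /a /g !autME autVK.
have fag : act (autM b (autV b3)) y = y by apply: fb.
have fg : act g y = y.
  have fag' : act (autM a g) y = y by rewrite -[RHS]fag; apply: act_ext.
  by rewrite -(actVK a (act g y)) -(actM a g) fag' stabV.
have [l [nd sz hl]] := deg4 y.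
have L := nbr_lperm hl.
move=> x /hl; apply: (local_inverters y nd sz (L s fs) (L s2 fs2) (L a fa) (L g fg) (L v2 (hv v2 d2))) => {}x.
- exact: (act3 _ hs).
- rewrite -!actM; apply: act_ext => z; rewrite !autME.
  by rewrite -(rigid_comm _ D12 rs (rigidV rb2)) bE.
- rewrite -!actM; apply: act_ext => z.
  rewrite !autME !autVK.
  by rewrite -(rigid_comm _ D13 rs (rigidV rb3)) bE.
- by rewrite -!actM; apply: act_ext => z; rewrite !autME conjAE.
- rewrite -!actM; apply: act_ext => z; rewrite !autME.
  rewrite -(rigid_comm _ D23 rs2 (rigidV rb3)).
  rewrite -(autKV v2 (autV b3 z)); move: (autV v2 _) => z'.
  by rewrite /s2 /b2 !conjAE bE.
- exact: (act3 _ Rs2).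
Qed.

Lemma ssub_inactive e1 e2 y s : edge e2 -> fixR e2 y -> ssub e1 e2 -> Rot e1 s -> trivN s y.
Proof.
move=> he hf [c hc sub] hs; apply: (child_inactive he (fixR_tame_at he hf) hc).
exact: Rot_mono hs.
Qed.

Lemma fixR_nbr e c y x : edge e -> tame_at e y -> child e c -> adjW y x -> fixR (e.2, c) x.
Proof. by move=> he hy hc ax s hs; apply: (child_inactive he hy hc hs). Qed.

(** Rotations in [(t1, u)] carry [t2] to the remaining neighbours of [u], so [fixR] holds for all
    half-trees with head [u]. Hence the even inverter of a rotation about [u] fixes [y]; other
    rotations lie in proper half-subtrees. *)
Lemma same_head_inactive t1 t2 u y : fixR (t1, u) y -> fixR (t2, u) y ->
  T5adj t2 u -> t1 <> t2 -> ~ active y (t1, u).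
Proof.
move=> f1 f2 a2 ne [a1 _ [s hs]]; apply.
have all t : T5adj t u -> fixR (t, u) y.
  move=> at_; case: (classic (t = t1)) => [-> //|n1]; case: (classic (t = t2)) => [-> //|n2].
  have c2 : child (t1, u) t2 by split; [apply: T5adj_sym | move=> e; apply: ne].
  have c3 : child (t1, u) t by split; [apply: T5adj_sym |].
  have [r hr rt] := Rot_moves a1 c2 c3 (fun e => n2 (esym e)).
  have := fixR_move (g := r) f2; rewrite f1 // /moveE /= rt.
  by rewrite (rigid_head a1 (Rot_rigid hr)).
have [g hg sub] := hs.
have eg : edge (moveE g e0) by apply/edge_move; apply: edge_e0.
have [e|ss] := sube_cases eg a1 sub; last by apply: (ssub_inactive a1 f1 ss); exists g => //; apply: sube_refl.
have gu : g T5root = u by case: e.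
have [r1 [r2 [h1 h2 rr]]] := Rot_center_even hg.
have fk : fixR (g (v1 o2), g T5root) y.
  by rewrite gu; apply: all; rewrite -gu; apply/aut_adj/T5adj_sym/T5adj_nbT.
have [l [nd sz hl]] := deg4 y.
have L := nbr_lperm hl.
move=> x /hl; apply: (local_even_inverter y nd sz (L s (f1 s hs)) (L r1 (fk r1 h1)) (L r2 (fk r2 h2))) => {}x.
- exact: (act3 _ hs).
- exact: (act3 _ h1).
- exact: (act3 _ h2).
- by rewrite -!actM; apply: act_ext => z; rewrite !autME rr.
Qed.

(** For distinct heads, the ping-pong elements stabilise [y] with unbounded displacement, against
    [stab_bounded]. *)
Lemma codisj_inactive e1 e2 y : edge e1 -> edge e2 -> codisj e1 e2 ->
  fixR e1 y -> fixR e2 y -> ~ active y e2.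
Proof.
move=> a1 a2 cd f1 f2; case: (classic (e1.2 = e2.2)) => [e|ne].
  case: e1 e2 a1 a2 cd e f1 f2 => [t1 u1] [t2 u2] /= a1 a2 [h1 h2 _] e f1 f2; subst u2.
  apply: (same_head_inactive f2 f1) => // e.
  by subst t2; move/inT_tail: h1.
have [r [r' [hr hr' far]]] := codisj_unbounded a1 a2 cd ne.
have [N hN] := stab_bounded y e1.2.
have fixit n : exists2 g : AutT5, act g y = y & forall z, g z = iter n (fun z => r (r' z)) z.
  elim: n => [|n [g gy gE]]; first by exists aut1 => //; apply: act1.
  by exists (autM (autM r r') g) => [|z]; [rewrite !actM gy (f2 r') // (f1 r) | rewrite !autME gE].
have [g gy gE] := fixit N.+1.
by have := far N.+1; rewrite -gE => /leq_trans /(_ (hN g gy)); rewrite ltnn.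
Qed.

(** By openness the stabiliser of [w] contains the pointwise stabiliser of a finite set; take a
    half-tree pointing outward beyond that set. *)
Lemma fixR_exists : exists2 e, edge e & fixR e w.
Proof.
case: CA => _ [_ [_ [_ [_ [_ [_ [_ /(_ w) [op _]]]]]]]].
have [|F hF] := op aut1; first by apply: act1.
pose N := \max_(x <- F) dist x T5root.
have hN x : In x F -> dist x T5root <= N.
  rewrite /N; elim: (F) => //= a l IH; rewrite big_cons => -[->|/IH]; first exact: leq_maxl.
  by move=> /leq_trans; apply; apply: leq_maxr.
have [t [u [a et eu]]] := edge_outward N; exists (t, u) => // s /Rot_rigid rs.
apply: hF => x /hN hx; apply: rs => hx'.
have nr : ~ inT t u T5root by rewrite /inT !(distC T5root) et eu; lia.
by have := dist_cut a hx' nr; lia.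
Qed.

(** Edge transitivity moves [e] to an edge with a rotation displacing the root beyond the bound for
    the stabiliser of [w]. *)
Lemma not_fixR_all e : edge e -> ~ (forall y, fixR e y).
Proof.
move=> he h; have [N hN] := stab_bounded w T5root.
have [e' [r [he' hr far]]] := Rot_moves_far N.
have [g1 eg1] := edge_transitive he; have [g2 eg2] := edge_transitive he'.
pose g := autM g2 (autV g1).
have ge : moveE g e = e' by rewrite -eg1 -eg2 /moveE /g !autME !autVK.
have := fixR_move (g := g) (h (act (autV g) w)); rewrite ge actKV => /(_ r hr) /hN.
by rewrite leqNgt far.
Qed.

(** Otherwise [fixR e] would spread from [w] over the connected graph W. *)
Lemma active_exists y : exists e, active y e.
Proof.
have [e he hw] := fixR_exists.
suff [x [e' hx]] : exists x e', active x e'.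
  by have [g <-] := act_transitive x y; exists (moveE g e'); apply: active_move.
apply: NNPP => none; apply: (not_fixR_all he); apply: (adjW_ind hw) => y' z a fy s hs.
apply: NNPP => nz; apply: none; exists y', e; split=> //; exists s => // tr.
exact/nz/tr.
Qed.

(* The local action of the rotations in e is the alternating group on four points. *)
Definition special (y : W) (e : T5 * T5) : Prop :=
  [/\ edge e, fixR e y & exists2 v, Dbl e v & ~ trivN v y].

Lemma special_move g y e : special y e -> special (act g y) (moveE g e).
Proof.
case=> he hf [s hs ns]; split; [by apply/edge_move | exact: fixR_move |].
by exists (conjA g s); [apply: Dbl_conj | move/trivN_conj].
Qed.

Lemma Dbl_trivN e v y : Dbl e v -> (forall s, Rot e s -> trivN s y) -> trivN v y.
Proof.
case=> r [r' [hr hr' hv _]] h x ax.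
by rewrite (act_ext (h := autM r r')) // actM (h r') // (h r).
Qed.

Lemma act2 e v x : Dbl e v -> act v (act v x) = x.
Proof. by case=> r [r' [_ _ _ hv]]; rewrite -actM; apply: act1 => z; rewrite autME hv. Qed.

(** [v] commutes with [s], which acts locally as a 3-cycle, and no nontrivial involution of at most
    four points does. *)
Lemma active_disj e1 e2 v y : active y e1 -> disj e1 e2 -> Dbl e2 v -> act v y = y -> trivN v y.
Proof.
case=> _ f1 [s hs ns] D hv vy.
have [l [nd sz hl]] := deg4 y; have L := nbr_lperm hl.
have [|||h|h] := local_centralizer y nd sz (L s (f1 s hs)) (L v vy).
- by move=> x; apply: (act3 _ hs).
- by move=> x; apply: (act2 _ hv).
- move=> x; rewrite -!actM; apply: act_ext => z; rewrite !autME.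
  exact: (rigid_comm _ D (Rot_rigid hs) (Dbl_rigid hv)).
- by case: ns => x /hl; apply: h.
- by move=> x /hl; apply: h.
Qed.

Lemma tame_at_nbr e y x : edge e -> (forall e', active y e' -> ~ special y e') ->
  tame_at e y -> adjW y x -> tame_at e x.
Proof.
move=> he tame hy ax; split=> [c hc|v hv]; first exact: (fixR_nbr he hy hc ax).
suff : trivN v y by apply.
have vy : act v y = y by case: hy => _; apply.
(* Compare [e] with an active [e2]: either [v] acts trivially near [y], or the position is
   contradictory. *)
have [e2 ac2] := active_exists y; have [he2 f2 [s hs ns]] := ac2.
have [E|[D|[S|[S|cd]]]] := edge_cases he he2.
- subst e2; apply: NNPP => nv; apply: (tame e) => //; split=> //; by exists v.
- exact: (active_disj ac2 (disj_sym D) hv vy).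
- by apply: (Dbl_trivN hv) => r hr; apply: (ssub_inactive he2 f2 S hr).
- case: S => c hc sub; case: ns.
  by apply: (child_inactive he hy hc); apply: Rot_mono hs.
(* With equal heads, [v2] moves the tail of [e2] and yields a second half-tree with that head. With
   distinct heads, a child of [e] is still in covering position with [e2]. *)
exfalso; case: (classic (e2.2 = e.2)) => [E|ne].
  case: cd => h1 h2 h3.
  have hc : child e e2.1.
    split; first by rewrite -E; apply: T5adj_sym.
    by move=> e'; move: h1; rewrite e'; apply: inT_tail.
  have [v2 [_ [d2 _ [n _ _]]]] := Dbl_moves he hc.
  have v2y : act v2 y = y by case: hy => _; apply.
  have f3 := fixR_move (g := v2) f2; rewrite v2y /moveE E in f3.
  rewrite (rigid_head he (Dbl_rigid d2)) in f3.
  rewrite (surjective_pairing e2) E in f2 ac2.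
  apply: (same_head_inactive f2 f3) => //.
  rewrite -(rigid_head he (Dbl_rigid d2)); apply/aut_adj; apply: T5adj_sym; by case: hc.
have [c hc cd'] := codisj_child he he2 cd ne.
apply: (codisj_inactive _ he2 cd' _ f2 ac2); first by case: hc.
by case: hy => + _; apply.
Qed.

Lemma special_active y e : special y e -> active y e.
Proof.
case=> he hf [v hv nv]; split=> //; apply: NNPP => h; apply: nv; apply: (Dbl_trivN hv) => s hs.
by apply: NNPP => ns; apply: h; exists s.
Qed.

(** Otherwise [tame_at e] would spread over W, and a child of [e] would contradict
    [not_fixR_all]. *)
Lemma special_exists y : exists e, special y e.
Proof.
suff [x [e he]] : exists x e, special x e.
  by have [g <-] := act_transitive x y; exists (moveE g e); apply: special_move.
apply: NNPP => none; have [e [he fe _]] := active_exists w.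
have [c hc _] := child_avoid e.1 he.
have tame : forall y, tame_at e y.
  apply: (adjW_ind (fixR_tame_at he fe)) => y1 y2 a hy.
  by apply: (tame_at_nbr he _ hy a) => e' _ sp; apply: none; exists y1, e'.
apply: (not_fixR_all (child_edge hc)) => y1.
by case: (tame y1) => + _; apply.
Qed.

(** Every position of two distinct edges forces the witness [v] of [e1] or [s] of [e2] to act
    trivially at [y]. *)
Lemma special_unique y e1 e2 : special y e1 -> active y e2 -> e1 = e2.
Proof.
move=> sp ac2; have [he1 f1 [v hv nv]] := sp; have [he2 f2 [s hs ns]] := ac2.
have vy : act v y = y by case: (fixR_tame_at he1 f1) => _; apply.
have [//|[D|[S|[S|cd]]]] := edge_cases he1 he2; exfalso.
- by apply: nv; apply: (active_disj ac2 (disj_sym D) hv vy).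
- by apply: nv; apply: (Dbl_trivN hv) => r hr; apply: (ssub_inactive he2 f2 S hr).
- by apply: ns; apply: (ssub_inactive he1 f1 S hs).
- exact: (codisj_inactive he1 he2 cd f1 f2 ac2).
Qed.

(** [v = r r'] is locally a nontrivial involution, so [local_transitive] applies; [k] is a word in
    [r] and [r']. *)
Lemma special_transitive y e x1 x2 : special y e -> adjW y x1 -> adjW y x2 ->
  exists k, [/\ rigid e k, act k y = y & act k x1 = x2].
Proof.
case=> he f [v [r [r' [hr hr' vE vv]]] nv].
have [l [nd sz hl]] := deg4 y; have L := nbr_lperm hl.
move=> /hl h1 /hl h2.
have [||||wd hw] := local_transitive y nd sz (L r (f r hr)) (L r' (f r' hr')) _ _ _ _ h1 h2.
- by move=> x; apply: (act3 _ hr).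
- by move=> x; apply: (act3 _ hr').
- by move=> x; rewrite -!actM; apply: act1 => z; rewrite !autME -!vE vv.
- move=> h; apply: nv => x /hl /h /= e'.
  by rewrite (act_ext (h := autM r r')) // actM.
suff [k [hk ky kE]] : exists k, [/\ rigid e k, act k y = y &
    act k x1 = foldr (fun (b : bool) z => if b then act r z else act r' z) x1 wd].
  by exists k; rewrite kE.
elim: (wd) => [|b wd' [k [hk ky kE]]] /=.
  by exists aut1; split=> //; apply: act1.
case: b; [exists (autM r k) | exists (autM r' k)]; split; rewrite ?actM ?ky ?kE //.
- by apply: rigidM => //; apply: Rot_rigid.
- exact: f.
- by apply: rigidM => //; apply: Rot_rigid.
- exact: f.
Qed.

(* G is arc-transitive, so some g swaps y and x, hence also their special edges; this excludes
   proper nesting of these edges. *)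
Lemma special_head_nbrs y x1 x2 e e1 e2 : special y e -> adjW y x1 -> adjW y x2 ->
  special x1 e1 -> special x2 e2 -> e1.2 = e2.2.
Proof.
move=> sp a1 a2 s1 s2; have [he f _] := sp; have [he1 f1 _] := s1.
(* [g0] sends [x1] to [y]; correcting it by [k0], which fixes [y], gives the swap [g]. *)
have [g0 g0E] := act_transitive x1 y.
have ag : adjW y (act g0 y) by rewrite -{1}g0E; apply/act_adj/adjW_sym.
have [k0 [_ k0y k0E]] := special_transitive sp ag a1.
pose g := autM k0 g0.
have gx : act g x1 = y by rewrite actM g0E.
have gy : act g y = x1 by rewrite actM.
have E1 : moveE g e1 = e.
  apply/esym/(special_unique sp); rewrite -gx; exact/special_active/special_move.
have E2 : moveE g e = e1.
  apply/esym/(special_unique s1); rewrite -gy; exact/special_active/special_move.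
have [k [rk ky kx]] := special_transitive sp a1 a2.
have <- : moveE k e1 = e2.
  by apply/esym/(special_unique s2); rewrite -kx; exact/special_active/special_move.
(* It remains that [k], which is supported in [e], fixes the head of [e1]. *)
apply/esym => /=.
have [E|[D|[S|[S|cd]]]] := edge_cases he he1.
- by rewrite -E; apply: rigid_head.
- by apply: rk => h; apply: (D _ h); apply: inT_head.
- by case: (ssub_asym he he1 S); have := ssub_move g S; rewrite E1 E2.
- by case: (ssub_asym he1 he S); have := ssub_move g S; rewrite E1 E2.
case: (classic (e1.2 = e.2)) => [->|ne]; first exact: rigid_head.
have [c hc cd'] := codisj_child he he1 cd ne.
case: (codisj_inactive (child_edge hc) he1 cd' _ f1 (special_active s1)).
exact: (fixR_nbr he (fixR_tame_at he f) hc a1).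
Qed.

Lemma no_small_degree : False.
Proof.
have [e sp] := special_exists w; have [he _ [v _ nv]] := sp.
have [x ax] : exists x, adjW w x.
  by apply: NNPP => h; apply: nv => x ax; case: h; exists x.
have [e1 sp1] := special_exists x.
pose H y u := forall e', special y e' -> e'.2 = u.
have Hsp y e' : special y e' -> H y e'.2.
  by move=> s e2 s2; rewrite (special_unique s (special_active s2)).
pose P y u1 u2 := H y u1 /\ forall z, adjW y z -> H z u2.
(* Neighbours of a vertex share one head, so crossing an edge swaps the head at the vertex with the
   common head of its neighbours. *)
have Pstep y z u1 u2 : adjW y z -> P y u1 u2 -> P z u2 u1.
  move=> a [h1 h2]; split; first exact: h2.
  have [ez sz] := special_exists z; have [ey sy] := special_exists y.
  by move=> t at_ et st; rewrite -(h1 ey sy); apply: (special_head_nbrs sz at_ (adjW_sym a) st sy).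
have two : forall y, P y e.2 e1.2 \/ P y e1.2 e.2.
  apply: (adjW_ind (x := w)) => [|y z a [/(Pstep _ _ _ _ a)|/(Pstep _ _ _ _ a)]]; [left|by right|by left].
  split; first exact: Hsp.
  by move=> z az ez sz; apply: (special_head_nbrs sp az ax sz sp1).
(* Transitivity on T_5 makes every vertex a head, which leaves only two vertices; but [e.2] has two
   distinct neighbours. *)
have hit u : u = e.2 \/ u = e1.2.
  have [g gE] : exists g : AutT5, g e.2 = u.
    by exists (autM (tr u) (tr (invT e.2))); rewrite autME tr_inv tr_root.
  have := special_move g sp; rewrite -gE => s'.
  by case: (two (act g w)) => -[/(_ _ s') + _] /=; [left | right].
have [c [ac nc] _] := child_avoid e.1 he.
have [c' [ac' nc'] ne'] := child_avoid c he.
have n1 : c <> e.2 by move=> e'; rewrite e' in ac; apply: T5adj_irr ac.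
have n2 : c' <> e.2 by move=> e'; rewrite e' in ac'; apply: T5adj_irr ac'.
case: (hit c) => // E; case: (hit c') => // E'.
by apply: ne'; rewrite E E'.
Qed.

End LowerBound.

(** * The tree is a Cayley-Abels graph *)

Lemma In_map_eq (A : eqType) (B : Type) (f : A -> B) s y :
  In y [seq f x | x <- s] <-> exists2 x, x \in s & y = f x.
Proof.
elim: s => [|a s IH] /=; first by split=> // -[].
split=> [[<-|/IH [x hx ->]]|[x]]; first by exists a; rewrite ?mem_head.
  by exists x; rewrite // inE hx orbT.
by rewrite inE => /orP[/eqP -> ->|hx e]; [left | right; apply/IH; exists x].
Qed.

Lemma NoDup_map_inj (A : eqType) (B : Type) (f : A -> B) s :
  injective f -> uniq s -> NoDup [seq f x | x <- s].
Proof.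
move=> fi; elim: s => [|a s IH] /=; first by constructor.
move=> /andP[na us]; constructor; last exact: IH.
by move=> /In_map_eq [x hx /fi e]; rewrite e hx in na.
Qed.

Lemma T5_deg v : deg_at T5adj v 5.
Proof.
exists [seq nbT a v | a <- enum 'I_5]; split; last split.
- by apply: NoDup_map_inj; [apply: nbT_inj | apply: enum_uniq].
- by rewrite -[length _]/(size _) size_map size_enum_ord.
move=> y; rewrite In_map_eq; split=> [/T5adjP [a ->]|[a _ ->]]; last exact: T5adj_nbT.
by exists a; rewrite ?mem_enum.
Qed.

Lemma T5_connected x y : clos_refl_trans T5 T5adj x y.
Proof.
move En: (dist x y) => n; elim: n x En => [|n IH] x En.
  by rewrite (dist_eq0 En); apply: rt_refl.
have ne : x <> y by move=> e; rewrite e distxx in En.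
have [x' [a e]] := closer_exists ne.
by apply: (@rt_trans _ _ _ x'); [apply: rt_step | apply: IH; lia].
Qed.

Lemma sphere_finite v n : exists l : list T5, forall x, dist x v = n -> In x l.
Proof.
elim: n => [|n [l hl]]; first by exists [:: v] => x /dist_eq0 ->; left.
exists (flat_map (fun x => [seq nbT a x | a <- enum 'I_5]) l) => x ex.
have ne : x <> v by move=> e; rewrite e distxx in ex.
have [x' [a e]] := closer_exists ne.
apply/in_flat_map; exists x'; split; first by apply: hl; lia.
have /T5adjP [i ->] := T5adj_sym a.
by apply/In_map_eq; exists i; rewrite ?mem_enum.
Qed.

(** * Compactness of vertex stabilisers by Koenig's lemma *)

Section Compactness.

Variables (v : T5) (I : Type) (U : I -> AutT5 -> Prop).

Definition fincov (S : AutT5 -> Prop) : Prop :=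
  exists l : list I, forall g, S g -> exists i, In i l /\ U i g.

(** Since [S] fixes [v], the images of [z] lie on a finite sphere around [v]. *)
Lemma fincov_split (S : AutT5 -> Prop) z : (forall g, S g -> g v = v) ->
  (forall y, fincov (fun g => S g /\ g z = y)) -> fincov S.
Proof.
move=> hS h; have [L hL] := sphere_finite v (dist z v).
have [l hl] : fincov (fun g => S g /\ In (g z) L).
  elim: (L) => [|y L' [l' hl']]; first by exists [::] => g [].
  have [l hl] := h y; exists (l ++ l') => g [Sg [e|i]].
    by have [j [hj Uj]] := hl g (conj Sg (esym e)); exists j; split=> //; apply/in_app_iff; left.
  by have [j [hj Uj]] := hl' g (conj Sg i); exists j; split=> //; apply/in_app_iff; right.
exists l => g Sg; apply: hl; split=> //; apply: hL.
by rewrite -{1}(hS g Sg) dist_aut.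
Qed.

Definition vertex (n : nat) : T5 := odflt T5root (unpickle n : option {s | reduced s}).
Definition rank (x : T5) : nat := pickle (x : {s | reduced s}).

Lemma rankK : cancel rank vertex.
Proof. by move=> x; rewrite /vertex /rank pickleK. Qed.

(** The branch followed in Koenig's lemma: an image of [z] whose piece of [S] has no finite
    subcover, and an arbitrary vertex if there is none. *)
Definition image_choice (S : AutT5 -> Prop) (z : T5) : T5 :=
  epsilon (inhabits T5root) (fun y => ~ fincov (fun g => S g /\ g z = y)).

Fixpoint approx (n : nat) : AutT5 -> Prop :=
  if n is n'.+1 then fun g => approx n' g /\ g (vertex n') = image_choice (approx n') (vertex n')
  else fun g => g v = v.

Definition limit (x : T5) : T5 := image_choice (approx (rank x)) x.

Lemma approx_stab n g : approx n g -> g v = v.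
Proof. by elim: n => //= n IH [/IH]. Qed.

Lemma approx_limit n g x : approx n g -> rank x < n -> g x = limit x.
Proof.
elim: n => //= n IH [ag e]; rewrite ltnS leq_eqVlt => /orP[/eqP e'|]; last exact: IH.
by move: e; rewrite -e' rankK.
Qed.

Hypothesis nocov : ~ fincov (fun g => g v = v).

Lemma approx_nocov n : ~ fincov (approx n).
Proof.
elim: n => //= n IH.
apply: (epsilon_spec (inhabits T5root) (fun y => ~ fincov (fun g => approx n g /\ g (vertex n) = y))).
apply: not_all_ex_not => h; apply: IH; apply: (fincov_split _ h) => g; exact: approx_stab.
Qed.

Lemma approx_exists (l : list T5) : exists n, (exists g, approx n g) /\
  forall g x, approx n g -> In x l -> g x = limit x.
Proof.
exists (\max_(x <- l) rank x).+1; split.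
  apply: NNPP => h; apply: (@approx_nocov (\max_(x <- l) rank x).+1).
  by exists [::] => g ag; case: h; exists g.
move=> g x ag hx; apply: (approx_limit ag); rewrite ltnS.
elim: l hx {ag} => //= a l IH; rewrite big_cons => -[->|/IH]; first exact: leq_maxl.
by move=> /leq_trans; apply; apply: leq_maxr.
Qed.

(** A preimage lies on the sphere of radius [dist y v], and some approximation agrees with [limit]
    on that finite set. *)
Lemma limit_surj y : exists x, limit x = y.
Proof.
have [L hL] := sphere_finite v (dist y v).
have [n [[g ag] gl]] := approx_exists L.
exists (autV g y); rewrite -(gl g) ?autKV //; apply: hL.
by rewrite -[in LHS](dist_aut g) autKV (approx_stab ag).
Qed.

Lemma limit_aut : is_graph_aut T5adj limit.
Proof.
have inj : injective limit.
  move=> x y; have [n [[g ag] gl]] := approx_exists [:: x; y].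
  by rewrite -!(gl g) //=; [move/aut_inj | right; left | left].
split; last first.
  move=> x y; have [n [[g ag] gl]] := approx_exists [:: x; y].
  by rewrite -!(gl g) ?aut_adj //=; [right; left | left].
pose f y := proj1_sig (constructive_indefinite_description _ (limit_surj y)).
have fK : cancel f limit by move=> y; rewrite /f; case: constructive_indefinite_description.
by exists f => // x; apply: inj; rewrite fK.
Qed.

End Compactness.

(** Without a finite subcover, [limit] is an automorphism in some open [U i]; an approximation
    prescribing enough images then lies inside [U i] alone. *)
Lemma T5_stab_compact v : perm_compact (fun g : AutT5 => g v = v).
Proof.
move=> I U opn cov; apply: NNPP => nocov.
pose g0 : AutT5 := exist _ _ (limit_aut nocov).
have g0v : g0 v = v.
  have [n [[g ag] gl]] := approx_exists nocov [:: v].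
  by rewrite -[LHS](gl g) ?(approx_stab ag) //; left.
have [i Ui] := cov g0 g0v; have [F hF] := opn i g0 Ui.
have [n [_ gl]] := approx_exists nocov F.
apply: (@approx_nocov _ _ _ nocov n); exists [:: i] => g ag; exists i; split; first by left.
by apply: hF => x /(gl g x ag).
Qed.

Lemma T5_cayley_abels : is_cayley_abels T5adj T5act.
Proof.
split; first exact: T5adj_sym.
split; first exact: T5adj_irr.
split; first exact: T5_connected.
split; first by move=> x; have [l [_ [_ h]]] := T5_deg x; exists l => y /h.
split; first by move=> g x h; apply: h.
split; first by move=> g h k x e; apply: e.
split; first by move=> g; apply: (proj2_sig g).
split.
  by move=> x y; exists (autM (tr y) (tr (invT x))); rewrite /T5act autME tr_inv tr_root.
move=> x; split; last exact: T5_stab_compact.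
by move=> g gx; exists [:: x] => h hx; rewrite /T5act hx //; left.
Qed.

Theorem theorem6p1 :
  md_is T5adj 5 /\
  (is_cayley_abels T5adj T5act /\ forall v : T5, deg_at T5adj v 5).
Proof.
split; last by split; [apply: T5_cayley_abels | apply: T5_deg].
split.
  exists T5, T5adj, T5act; split; first exact: T5_cayley_abels.
  by exists T5root; apply: T5_deg.
move=> W adjW act CA w d [l [nd [sz hl]]]; rewrite leqNgt; apply/negP => lt.
apply: (no_small_degree w CA) => x.
have [g gE] := act_transitive CA w x; subst x.
(* Vertex-transitivity transports the neighbour list of [w] to every vertex. *)
exists [seq act g y | y <- l]; split.
- elim: nd {sz hl} => [|a l' na _ IH] /=; constructor=> // h; apply: na.
  elim: l' h {IH} => //= b l' IH [/(can_inj (actVK CA g)) ->|/IH]; by [left | right].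
- by rewrite size_map -[size l]/(length l) sz.
move=> y; rewrite -(actKV CA g y) (act_adj CA) hl; move: (act _ y) => {}y.
elim: l {nd sz hl} => //= a l ->; split=> -[h|h]; [left; congr act | right | left | right] => //.
by apply: (can_inj (actVK CA g)).
Qed.
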